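(* Let $X:=\widehat{\mathrm{Gr}}(2,m)\subseteq\mathbb{A}^{n}$, $n=\binom m2$, be the affine cone over the Grassmannian of planes in $m$-space, with the action of $\mathbb{G}_{\mathrm m}^m$ given by $t\cdot x=(t_it_jx_{ij})_{i<j}$, and let $Z\subseteq X^{\mathrm{an}}$ be the associated closed subset (the image of $\mu$, defined in the context). Then the surjective projection $\mathrm{trop}: Z \to \mathrm{Trop}(X)$ has a continuous, $\mathbb{R}^m$-equivariant section $\mathrm{Trop}(X)\to Z$.
   Context: $\mathbb{R}_\infty := \mathbb{R}\cup\{\infty\}$ carries the topology of a half-open interval. $K$ is a field with a non-Archimedean valuation $v: K \to \mathbb{R}_\infty$, assumed surjective. For an affine variety $X$ over $K$, $X^{\mathrm{an}}$ is the set of all ring valuations $w: K[X] \to \mathbb{R}_\infty$ extending $v$, with the topology of pointwise convergence. For $X\subseteq\mathbb{A}^n$ closed, $\mathrm{trop}:X^{\mathrm{an}}\to\mathbb{R}_\infty^n$ sends $w$ to the vector of values of $w$ on the coordinates, and $\mathrm{Trop}(X)$ is its image. Here $\mathbb{A}^n$ has coordinates $x_{ij}$, $1\le i<j\le m$, and $X$ is the image of $(\mathbb{A}^m)^2\to\mathbb{A}^n$, $(y,z)\mapsto(y_iz_j-y_jz_i)_{i<j}$. The torus $\mathbb{G}_{\mathrm m}^m$ acts on $\mathbb{A}^n$ via $\phi(t)=(t_it_j)_{i<j}$, with corresponding integer matrix $A\in\mathbb{Z}^{n\times m}$, $(A\tau)_{ij}=\tau_i+\tau_j$; $X$ is stable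 under this action. Definition of $\mu$ and $Z$: every $f\in K[X]$ decomposes uniquely as a finite sum $f=\sum_{\beta\in\mathbb{Z}^m}f_\beta$ of weight vectors, i.e. $f_\beta(\phi(t)x)=t^\beta f_\beta(x)$. Define $\mu:\mathbb{R}^m\times X^{\mathrm{an}}\to X^{\mathrm{an}}$ by $\mu(\tau,w)(f):=\min_\beta(w(f_\beta)+\beta\cdot\tau)$, and let $Z$ be the image of $\mu$. The restriction of $\mu$ to $\mathbb{R}^m\times Z$ is a continuous action of $\mathbb{R}^m$ on $Z$. The group $\mathbb{R}^m$ acts on $\mathrm{Trop}(X)$ by $(\tau,\xi)\mapsto A\tau+\xi$ (with $c+\infty=\infty$). Equivariance is with respect to these actions. *)

(* Defs.v *)
From HB Require Import structures.
From mathcomp Require Import all_boot all_order all_algebra finmap.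
From mathcomp Require Import -(notations) mpoly.
From mathcomp Require Import all_classical all_reals all_analysis.

Set Implicit Arguments.
Unset Strict Implicit.
Unset Printing Implicit Defensive.

Import Order.TTheory GRing.Theory Num.Theory.
Local Open Scope classical_set_scope.
Local Open Scope quotient_scope.
Local Open Scope ring_scope.

Definition ordpair (m : nat) := {p : 'I_m * 'I_m | (p.1 < p.2)%N}.

HB.instance Definition _ (m : nat) := SubFinite.on (ordpair m).

Lemma card_ordpair (m : nat) : #|{: ordpair m}| = 'C(m, 2).
Proof.
rewrite card_sub -sum1_card.
rewrite -(pair_big_dep xpredT (fun i j : 'I_m => (i < j)%N) (fun _ _ => 1%N)) /=.
rewrite (exchange_big_dep xpredT) //= -bin2_sum big_mkord; apply: eq_bigr => j _.
by rewrite (big_ord_narrow (ltnW (ltn_ord j))) sum1_card card_ord.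
Qed.

(* [mpoly] numbers its variables: [x_ij] is variable number [enum_rank ij]. *)
Notation coord_poly K m := (mpoly #|{: ordpair m}| K).

Definition coord_eval (K : fieldType) (m : nat) (x : ordpair m -> K)
    (p : coord_poly K m) : K :=
  meval (fun k => x (enum_val k)) p.

Definition cone_Gr2 (K : fieldType) (m : nat) : set (ordpair m -> K) :=
  [set x | exists y z : 'I_m -> K, forall e : ordpair m,
     x e = y (val e).1 * z (val e).2 - y (val e).2 * z (val e).1].

(* Over an infinite field (a surjective valuation forces that) the ideal of
   the K-points is the ideal of the variety. *)
Definition vanishing_ideal (K : fieldType) (m : nat) : coord_poly K m -> bool :=
  fun p => `[< forall x, cone_Gr2 x -> coord_eval x p = 0 >].

Lemma cone_Gr2_0 (K : fieldType) (m : nat) : cone_Gr2 (fun _ : ordpair m => 0 : K).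
Proof. by exists (fun=> 0), (fun=> 0) => e; rewrite !mul0r subrr. Qed.

Lemma vanishing_ideal_closed (K : fieldType) (m : nat) :
  @idealr_closed (coord_poly K m) (@vanishing_ideal K m).
Proof.
split.
- by apply/asboolP => x _; rewrite /coord_eval meval0.
- apply/asboolP => /(_ _ (cone_Gr2_0 K m)) /eqP.
  by rewrite /coord_eval meval1 oner_eq0.
- move=> a p q /asboolP p0 /asboolP q0; apply/asboolP => x xX.
  rewrite /coord_eval mevalD mevalM.
  by move: (p0 x xX) (q0 x xX); rewrite /coord_eval => -> ->; rewrite mulr0 addr0.
Qed.

HB.instance Definition _ (K : fieldType) (m : nat) :=
  isIdealr.Build (coord_poly K m) (@vanishing_ideal K m)
    (@vanishing_ideal_closed K m).

Definition coord_ideal (K : fieldType) (m : nat) : idealr (coord_poly K m) :=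
  Idealr.clone _ (@vanishing_ideal K m) _.

Notation coord_ring K m := {ideal_quot (coord_ideal K m)}.

Definition ring_const (K : fieldType) (m : nat) (c : K) : coord_ring K m :=
  \pi_(coord_ring K m) (mpolyC _ c).

Definition ring_coord (K : fieldType) (m : nat) (e : ordpair m) : coord_ring K m :=
  \pi_(coord_ring K m)
    (mpolyX K (mnm1 (enum_rank e))).

(* the value of a regular function at a point, meaningful on the cone only *)
Definition ring_eval (K : fieldType) (m : nat) (x : ordpair m -> K)
    (f : coord_ring K m) : K := coord_eval x (repr f).

Lemma ring_eval_pi (K : fieldType) (m : nat) (x : ordpair m -> K)
    (p : coord_poly K m) :
  cone_Gr2 x -> ring_eval x (\pi_(coord_ring K m) p) = coord_eval x p.
Proof.
move=> xX; apply/eqP; rewrite -subr_eq0 /ring_eval /coord_eval -mevalB.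
have /eqP : repr (\pi_(coord_ring K m) p) = p %[mod coord_ring K m].
  by rewrite reprK.
by rewrite -Quotient.idealrBE => /asboolP /(_ x xX) /eqP.
Qed.

Lemma coord_ring_ext (K : fieldType) (m : nat) (f g : coord_ring K m) :
  (forall x, cone_Gr2 x -> ring_eval x f = ring_eval x g) -> f = g.
Proof.
elim/quotW: f => p; elim/quotW: g => q fg.
apply/eqP; rewrite -Quotient.idealrBE; apply/asboolP => x xX.
by move: (fg x xX); rewrite !ring_eval_pi // /coord_eval mevalB => ->; rewrite subrr.
Qed.

Lemma ring_evalD (K : fieldType) (m : nat) x : cone_Gr2 x ->
  {morph @ring_eval K m x : f g / f + g}.
Proof.
move=> xX; elim/quotW => p; elim/quotW => q.
by rewrite -pi_addr !ring_eval_pi // /coord_eval mevalD.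
Qed.

Lemma ring_eval0 (K : fieldType) (m : nat) x : cone_Gr2 x ->
  @ring_eval K m x 0 = 0.
Proof.
move=> xX; have /eqP := ring_evalD xX 0 0.
by rewrite addr0 -subr_eq0 opprD addNKr oppr_eq0 => /eqP.
Qed.

Lemma ring_eval_sum (K : fieldType) (m : nat) x (I : Type) (s : seq I)
   (F : I -> coord_ring K m) : cone_Gr2 x ->
  ring_eval x (\sum_(i <- s) F i) = \sum_(i <- s) ring_eval x (F i).
Proof. by move=> xX; exact: (big_morph _ (ring_evalD xX) (ring_eval0 xX)). Qed.

Notation weight m := {ffun 'I_m -> int}.

Definition torus_act (K : fieldType) (m : nat) (t : 'I_m -> K)
    (x : ordpair m -> K) : ordpair m -> K :=
  fun e => t (val e).1 * t (val e).2 * x e.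

Lemma torus_act_cone (K : fieldType) (m : nat) (t : 'I_m -> K) (x : ordpair m -> K) :
  cone_Gr2 x -> cone_Gr2 (torus_act t x).
Proof.
move=> [y [z xE]]; exists (fun i => t i * y i), (fun i => t i * z i) => e.
by rewrite /torus_act xE mulrBr !mulrA (mulrAC _ _ (y _)) (mulrC (t _) (t _)) (mulrAC _ (t _) (y _)).
Qed.

Definition weight_vector (K : fieldType) (m : nat) (b : weight m)
    (f : coord_ring K m) : Prop :=
  forall t : 'I_m -> K, (forall i, t i != 0) ->
  forall x, cone_Gr2 x ->
    ring_eval (torus_act t x) f = (\prod_i t i ^ b i) * ring_eval x f.

Definition weight_decomposition (K : fieldType) (m : nat) (f : coord_ring K m)
    (d : weight m -> coord_ring K m) : Prop :=
  [/\ finite_set [set b | d b != 0],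
      forall b, weight_vector b (d b) &
      f = \sum_(b \in [set: weight m]) d b].

Lemma characters_free (K : fieldType) (m : nat) (a : K) (s : seq (weight m))
   (c : weight m -> K) :
  a != 0 -> (forall k : int, a ^ k = 1 -> k = 0) -> uniq s ->
  (forall t : 'I_m -> K, (forall i, t i != 0) ->
     \sum_(b <- s) (\prod_i t i ^ b i) * c b = 0) ->
  forall b, b \in s -> c b = 0.
Proof.
move=> a0 aoo; elim: s c => [//|b0 s IH] c /= /andP[b0s us] H.
pose chi (t : 'I_m -> K) (b : weight m) := \prod_i t i ^ b i.
have cs : forall b, b \in s -> c b = 0.
  move=> b bs.
  have [i bi] : exists i, b i != b0 i.
    apply/existsP; rewrite -negb_forall; apply/negP => /forallP bb.
    by move: b0s; rewrite -(_ : b = b0) ?bs //; apply/ffunP => i; apply/eqP.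
  pose u j := if j == i then a else 1.
  have u0 j : u j != 0 by rewrite /u; case: ifP => // _; exact: oner_neq0.
  have chiu b' : chi u b' = a ^ b' i.
    rewrite /chi (bigD1 i) //= /u eqxx big1 ?mulr1 // => j /negbTE ->.
    by rewrite exp1rz.
  suff : (chi u b - chi u b0) * c b = 0.
    move/eqP; rewrite mulf_eq0 => /orP[|/eqP //]; rewrite !chiu subr_eq0 => /eqP E.
    case/eqP: bi; apply/eqP; rewrite -subr_eq0; apply/eqP/aoo.
    by rewrite expfzDr // E -expfzDr // subrr expr0z.
  apply: (IH (fun b => (chi u b - chi u b0) * c b)) => //.
  - move=> t t0; have H2 := H (fun j => u j * t j) (fun j => mulf_neq0 (u0 j) (t0 j)).
    have H1 := H t t0; rewrite !big_cons in H1 H2.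
    have E (b' : weight m) : \prod_j (u j * t j) ^ b' j = chi u b' * chi t b'.
      by rewrite -big_split; apply: eq_bigr => j _; rewrite expfzMl.
    transitivity (\sum_(j <- s) ((\prod_j0 (u j0 * t j0) ^ j j0) * c j)
       - chi u b0 * \sum_(j <- s) (\prod_i0 t i0 ^ j i0 * c j)).
      rewrite mulr_sumr -sumrB; apply: eq_bigr => b' _.
      by rewrite E -/(chi t b') mulrBl mulrBr !mulrA; congr (_ - _); congr (_ * _); rewrite mulrC.
    move/eqP: H1; rewrite addrC addr_eq0 => /eqP ->.
    move/eqP: H2; rewrite addrC addr_eq0 => /eqP ->.
    by rewrite E mulrN mulrA subrr.
move=> b; rewrite inE => /orP[/eqP ->|/cs //].
have := H (fun=> 1) (fun=> oner_neq0 _).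
rewrite big_cons [X in _ + X]big_seq [X in _ + X]big1 ?addr0; last first.
  by move=> j js; rewrite (cs j js) mulr0.
by rewrite big1 ?mul1r // => i _; rewrite exp1rz.
Qed.

Lemma weight_decomposition_uniq (K : fieldType) (m : nat) (a : K)
   (f : coord_ring K m) d d' :
  a != 0 -> (forall k : int, a ^ k = 1 -> k = 0) ->
  weight_decomposition f d -> weight_decomposition f d' -> d = d'.
Proof.
move=> a0 aoo [fd wd fE] [fd' wd' fE'].
pose S := finmap.fsetU (fset_set [set b | d b != 0]) (fset_set [set b | d' b != 0]).
have out b : b \notin S -> d b = 0 /\ d' b = 0.
  rewrite finmap.in_fsetU !in_fset_set // negb_or => /andP[/negP h /negP h'].
  by split; apply/eqP; [apply: contra_notT h|apply: contra_notT h'] => ?; apply/mem_set.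
have sumE : \sum_(b <- S) d b = \sum_(b <- S) d' b.
  by rewrite -!fsbigTE -?fE -?fE' // => b /out [].
apply/funext => b; apply: coord_ring_ext => x xX.
have [/[dup] bS|/out [-> -> //]] := boolP (b \in S).
apply: contraTeq => ne.
suff : ring_eval x (d b) - ring_eval x (d' b) = 0 by move/eqP; rewrite subr_eq0 (negbTE ne).
apply: (@characters_free K m a S (fun b => ring_eval x (d b) - ring_eval x (d' b))) => //.
  exact: finmap.fset_uniq.
move=> t t0.
have tX := torus_act_cone t xX.
have := congr1 (ring_eval (torus_act t x)) sumE; rewrite !ring_eval_sum // => /eqP.
rewrite -subr_eq0 -sumrB => /eqP E; rewrite -[RHS]E; apply: eq_bigr => b' _.
by rewrite wd // wd' // mulrBr.
Qed.

Lemma weight_decomposition_ex (K : fieldType) (m : nat) (f : coord_ring K m) :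
  exists d, weight_decomposition f d.
Proof.
elim/quotW: f => p.
pose n := #|{: ordpair m}|.
pose wt (mo : multinom n) : weight m :=
  [ffun i => (\sum_(e : ordpair m | (val e).1 == i) mo (enum_rank e)
            + \sum_(e : ordpair m | (val e).2 == i) mo (enum_rank e))%N%:Z].
pose mon mo : coord_poly K m := mcoeff mo p *: mpolyX K mo.
pose dp b : coord_poly K m := \sum_(mo <- msupp p | wt mo == b) mon mo.
pose W := finmap.seq_fset tt (map wt (msupp p)).
have out b : b \notin W -> dp b = 0.
  rewrite finmap.seq_fsetE => nb; rewrite /dp big1_seq // => mo /andP[/eqP E mop].
  by move: nb; rewrite -E map_f.
have pi0 : \pi_(coord_ring K m) (0 : coord_poly K m) = 0 by exact: pi_zeror.
have piD : {morph \pi_(coord_ring K m) : x y / x + y} by exact: pi_addr.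
exists (fun b => \pi_(coord_ring K m) (dp b)); split.
- apply: sub_finite_set (finite_fset W) => b /= nz.
  by apply: contraNT nz => /out ->; rewrite pi0 eqxx.
- move=> b t t0 x xX; rewrite !ring_eval_pi //; last exact: torus_act_cone.
  rewrite /coord_eval /dp !raddf_sum /= mulr_sumr; apply: eq_bigr => mo /eqP <-.
  rewrite !mevalZ !mevalX mulrCA; congr (_ * _).
  rewrite /torus_act.
  under [LHS]eq_bigr => i _. rewrite !exprMn. over.
  rewrite !big_split /=; congr (_ * _).
  have P (g : ordpair m -> 'I_m) : \prod_(i < n) t (g (enum_val i)) ^+ mo i =
      \prod_i t i ^+ (\sum_(e : ordpair m | g e == i) mo (enum_rank e))%N.
    under [RHS]eq_bigr do rewrite -prodrXr big_mkcond /=.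
    rewrite exchange_big /= (reindex (@enum_rank (ordpair m))) /=; last first.
      by exists enum_val => e _; rewrite ?enum_rankK ?enum_valK.
    apply: eq_bigr => e _; rewrite enum_rankK (bigD1 (g e)) //= eqxx big1 ?mulr1 //.
    by move=> i /negbTE; rewrite eq_sym => ->.
  rewrite (P (fun e => (val e).1)) (P (fun e => (val e).2)) -big_split; apply: eq_bigr => i _ /=.
  by rewrite ffunE -exprnP exprD.
- rewrite (@fsbigTE _ _ _ _ W) /=; last by move=> b /out ->; rewrite pi0.
  rewrite -(big_morph _ piD pi0).
  congr (\pi_(coord_ring K m) _); rewrite {1}(mpolyE p) /dp.
  rewrite (exchange_big_dep xpredT) //= big_seq [RHS]big_seq; apply: eq_bigr => mo mop.
  have moW : wt mo \in finmap.enum_fset W.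
    by rewrite [_ \in _]finmap.seq_fsetE map_f.
  rewrite -big_filter (_ : [seq _ <- _ | _] = [:: wt mo]) ?big_seq1 //.
  have eqs : [seq b <- finmap.enum_fset W | wt mo == b] =
             seq.filter (pred1 (wt mo)) (finmap.enum_fset W).
    by apply: eq_filter => b /=; rewrite eq_sym.
  by rewrite eqs filter_pred1_uniq // finmap.fset_uniq.
Qed.

Definition weight_component (K : fieldType) (m : nat) (f : coord_ring K m) :
    weight m -> coord_ring K m :=
  xget (fun=> 0) (weight_decomposition f).

(* [R_infty] is the set of [x : \bar R] with [x != -oo]. *)
Definition ring_valuation (R : realType) (S : comNzRingType) (w : S -> \bar R) :
    Prop :=
  [/\ forall f, w f != -oo%E,
      w 0 = +oo%E, w 1 = 0%E,
      forall f g, w (f * g) = (w f + w g)%E &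
      forall f g, (Order.min (w f) (w g) <= w (f + g)%R)%E].

Definition field_valuation (R : realType) (K : fieldType) (v : K -> \bar R) :
    Prop :=
  ring_valuation v /\ forall a, v a = +oo%E -> a = 0.

Lemma field_val_order (R : realType) (K : fieldType) (v : K -> \bar R) :
  field_valuation v -> (forall r : \bar R, r != -oo%E -> exists a, v a = r) ->
  exists2 a : K, a != 0 & forall k : int, a ^ k = 1 -> k = 0.
Proof.
move=> [[vN v0 v1 vM vA] _] vs; have [//|a va] := vs 1%:E.
have vX n : v (a ^+ n) = n%:R%:E.
  elim: n => [|n IH]; first by rewrite expr0 v1.
  by rewrite exprS vM IH va -EFinD -natr1 addrC.
have nat0 n : a ^+ n = 1 -> n = 0%N.
  by move/(congr1 v); rewrite vX v1 => -[] /eqP; rewrite pnatr_eq0 => /eqP.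
exists a; first by apply: contra_eqN va => /eqP ->; rewrite v0.
case=> n; first by move/nat0 ->.
by rewrite NegzE -exprnN => /(congr1 (fun x => x^-1)); rewrite invrK invr1 => /nat0.
Qed.

Lemma weight_componentP (R : realType) (K : fieldType) (v : K -> \bar R)
    (m : nat) (f : coord_ring K m) :
  field_valuation v -> (forall r : \bar R, r != -oo%E -> exists a, v a = r) ->
  forall d, weight_decomposition f d <-> d = weight_component f.
Proof.
move=> vP vs d; have [a a0 aoo] := field_val_order vP vs.
have wP : weight_decomposition f (weight_component f).
  by have [d' d'P] := weight_decomposition_ex f; apply: (xgetPex _ (ex_intro _ d' d'P)).
by split=> [dP|->//]; exact: (weight_decomposition_uniq a0 aoo dP wP).
Qed.

Notation val_space R K m := {ptws coord_ring K m -> \bar R}.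
Notation trop_space R m := {ptws ordpair m -> \bar R}.

Definition Xan (R : realType) (K : fieldType) (m : nat) (v : K -> \bar R) :
    set (val_space R K m) :=
  [set w | ring_valuation w /\ forall c, w (ring_const m c) = v c].

Definition trop (R : realType) (K : fieldType) (m : nat) (w : val_space R K m) :
    trop_space R m :=
  fun e => w (ring_coord K e).

Definition Trop (R : realType) (K : fieldType) (m : nat) (v : K -> \bar R) :
    set (trop_space R m) :=
  [set trop w | w in Xan v].

(* All but finitely many of the terms are [+oo], so the infimum is a minimum. *)
Definition mu (R : realType) (K : fieldType) (m : nat) (tau : 'I_m -> R)
    (w : val_space R K m) : val_space R K m :=
  fun f => ereal_inf
    [set (w (weight_component f b) + (\sum_i (b i)%:~R * tau i)%:E)%E
       | b in [set: weight m]].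

(* [mu] takes its values in [Xan v]; its image is taken inside that space. *)
Definition mu_image (R : realType) (K : fieldType) (m : nat) (v : K -> \bar R) :
    set (val_space R K m) :=
  [set u | Xan v u /\ exists tau w, Xan v w /\ u = mu tau w].

Definition trop_act (R : realType) (m : nat) (tau : 'I_m -> R)
    (xi : trop_space R m) : trop_space R m :=
  fun e => ((tau (val e).1 + tau (val e).2)%:E + xi e)%E.

(* Main.v *)
(* A point of the cone with Pluecker coordinates [x_ij = t_i t_j (u_j - u_i)] is
   given by scales [t_i] and points [u_i] of a line. If the [u_i] are listed in
   some order and their consecutive differences, the gaps, and the scales are
   treated as variables, a Gauss valuation in these variables pulls back to a
   valuation of [K[X]] that takes on [x_ij] the value
   [tau_i + tau_j + min delta_q], the minimum being over the gaps between [i] and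
   [j]. Every tropical point arises in this way: [X_ij - tau_i - tau_j], where
   [tau_j = min_a X_aj], is an ultrametric by the Pluecker relations, and an
   ultrametric is such a minimum as soon as every leaf is followed by the nearest
   of the remaining ones.

   In [K[X]] every element has a lift whose monomials are noncrossing for the
   chosen order. Distinct noncrossing monomials have distinct leading monomials
   in scales and gaps, so the valuation of an element is the minimum over the
   terms of its noncrossing lift, and it is at least the minimum over the terms
   of any other lift. Hence the maximum over all orders of the minimum over the
   terms of the noncrossing lift is a section. Being a finite maximum of finite
   minima of monomial expressions it is continuous, and it is equivariant since
   weight components of noncrossing polynomials are noncrossing. *)

Require Import Defs.
From mathcomp Require Import fingroup perm.
From mathcomp Require Import all_boot all_order all_algebra finmap.
From mathcomp Require Import -(notations) mpoly.
From mathcomp Require Import all_classical all_reals all_analysis.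
From mathcomp Require Import ring lra zify.

Set Implicit Arguments.
Unset Strict Implicit.
Unset Printing Implicit Defensive.

Import Order.TTheory GRing.Theory Num.Theory.
Local Open Scope classical_set_scope.
Local Open Scope ring_scope.

(** * Extrema over finite sequences *)

Lemma seq_has_max d (T : orderType d) (s : seq T) :
  s != [::] -> exists2 x, x \in s & forall y, y \in s -> (y <= x)%O.
Proof.
elim: s => // a [|b s] IH _.
  by exists a; [exact: mem_head|move=> y; rewrite inE => /eqP ->].
have [//|x xs xm] := IH; have [ax|xa] := leP a x.
  by exists x; [rewrite inE xs orbT|move=> y; rewrite inE => /orP[/eqP ->|/xm]].
exists a; [exact: mem_head|move=> y; rewrite inE => /orP[/eqP -> //|/xm yx]].
exact: le_trans yx (ltW xa).
Qed.

Section BigMin.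
Variables (R : realType) (I : eqType).
Implicit Types (s : seq I) (F : I -> \bar R).

Lemma le_bigmine s F (a : \bar R) :
  (forall i, i \in s -> (a <= F i)%E) -> (a <= \big[mine/+oo]_(j <- s) F j)%E.
Proof.
move=> H; rewrite big_seq; elim/big_ind: _ => [|x y ax ay|i /H //].
  by rewrite leey.
by rewrite le_min ax.
Qed.

Lemma bigmine_attained s F : (\big[mine/+oo]_(j <- s) F j < +oo)%E ->
  exists2 i, i \in s & F i = (\big[mine/+oo]_(j <- s) F j)%E.
Proof.
elim: s => [|a s IH]; first by rewrite big_nil ltxx.
rewrite big_cons; have [ab _|ba] := leP (F a) (\big[mine/+oo%E]_(j <- s) F j).
  by exists a; rewrite ?mem_head.
by move=> /IH[i si iE]; exists i; rewrite // inE si orbT.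
Qed.

End BigMin.

(** * Gauss valuations *)

Section Valuation.
Variables (R : realType) (S : comNzRingType) (w : S -> \bar R).
Hypothesis wP : ring_valuation w.

Let wNy f : w f != -oo%E. Proof. by case: wP. Qed.
Let w0 : w 0 = +oo%E. Proof. by case: wP. Qed.
Let w1 : w 1 = 0%E. Proof. by case: wP. Qed.
Let wM f g : w (f * g) = (w f + w g)%E. Proof. by case: wP. Qed.
Let wD f g : (Order.min (w f) (w g) <= w (f + g)%R)%E. Proof. by case: wP. Qed.

Lemma valuation_N1 : w (-1) = 0%E.
Proof.
have : (w (-1) + w (-1) = 0)%E by rewrite -wM mulrNN mulr1.
move: (wNy (-1)); case: (w (-1)) => [r| |] // _ [] /eqP.
by rewrite -mulr2n mulrn_eq0 orFb => /eqP ->.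
Qed.

Lemma valuationN f : w (- f) = w f.
Proof. by rewrite -mulN1r wM valuation_N1 add0e. Qed.

Lemma valuation_addl_lt f g : (w f < w g)%E -> w (f + g) = w f.
Proof.
move=> fg; apply/eqP; rewrite eq_le; apply/andP; split; last first.
  by apply: le_trans (wD f g); rewrite le_min lexx ltW.
have := wD (f + g) (- g); rewrite addrK valuationN ge_min => /orP[//|gf].
by move: (lt_le_trans fg gf); rewrite ltxx.
Qed.

Lemma valuation_sum_gt (I : eqType) (s : seq I) (F : I -> S) (a : \bar R) :
  (a < +oo)%E ->
  (forall i, i \in s -> (a < w (F i))%E) -> (a < w (\sum_(i <- s) F i)%R)%E.
Proof.
move=> aoo H; rewrite big_seq; elim/big_ind: _ => [|x y ax ay|i /H //].
  by rewrite w0.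
by apply: lt_le_trans (wD _ _); rewrite lt_min ax.
Qed.

Lemma valuation_sum_dominant (I : eqType) (s : seq I) (F : I -> S) (i : I) :
  uniq s -> i \in s -> (w (F i) < +oo)%E ->
  (forall j, j \in s -> j != i -> (w (F i) < w (F j))%E) ->
  w (\sum_(j <- s) F j) = w (F i).
Proof.
move=> us si fin H; rewrite (bigD1_seq i) //=; apply: valuation_addl_lt.
rewrite -big_filter; apply: valuation_sum_gt => // j.
by rewrite mem_filter => /andP[ji /H]; apply.
Qed.

Lemma valuation_prod (I : Type) (s : seq I) (F : I -> S) :
  w (\prod_(i <- s) F i) = \sum_(i <- s) w (F i).
Proof. exact: (big_morph w wM w1). Qed.

Lemma valuationX f n : w (f ^+ n) = w f *+ n.
Proof. by elim: n => [|n IH]; rewrite ?expr0 // exprS mulrS wM IH. Qed.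

End Valuation.

Section Gauss.
Variables (R : realType) (K : fieldType) (v : K -> \bar R).
Hypothesis vP : ring_valuation v.
Variable n : nat.
Implicit Types (w : 'I_n -> \bar R) (k l : multinom n) (p q : mpoly n K).

Let vNy f : v f != -oo%E. Proof. by case: vP. Qed.
Let v0 : v 0 = +oo%E. Proof. by case: vP. Qed.
Let v1 : v 1 = 0%E. Proof. by case: vP. Qed.
Let vM f g : v (f * g) = (v f + v g)%E. Proof. by case: vP. Qed.

Definition mono_weight w k : \bar R := (\sum_i w i *+ k i)%R.

Definition gauss_term w p k : \bar R := (v (mcoeff k p) + mono_weight w k)%E.

(** The Gauss valuation with weights [w]. A weight may be [+oo], so the value can be infinite on a
    nonzero polynomial. *)
Definition gauss w p : \bar R :=
  (\big[mine/+oo]_(k <- msupp p) gauss_term w p k)%E.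

Lemma mono_weightD w k l :
  mono_weight w (mnm_add k l) = (mono_weight w k + mono_weight w l)%E.
Proof.
by rewrite /mono_weight -big_split; apply: eq_bigr => i _; rewrite mnmDE mulrnDr.
Qed.

Lemma mono_weight0 w : mono_weight w mnm0 = 0%E.
Proof. by rewrite /mono_weight big1 // => i _; rewrite mnm0E. Qed.

Lemma mono_weight1 w i : mono_weight w (mnm1 i) = w i.
Proof.
rewrite /mono_weight (bigD1 i) //= mnm1E eqxx big1 ?addr0 // => j ji.
by rewrite mnm1E eq_sym (negbTE ji).
Qed.

Variable w : 'I_n -> \bar R.
Hypothesis wNy : forall i, w i != -oo%E.

Lemma mono_weightNy k : mono_weight w k != -oo%E.
Proof.
apply/eqP => /esum_eqNyP [i [_ _]]; move: (wNy i).
move=> wi; elim: (k i) => [|j IH]; first by rewrite mulr0n.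
by rewrite mulrS => /eqP; rewrite adde_eq_ninfty (negbTE wi) => /eqP.
Qed.

Lemma gauss_termNy p k : gauss_term w p k != -oo%E.
Proof. by rewrite adde_eq_ninfty negb_or vNy mono_weightNy. Qed.

Lemma gauss_le p k : (gauss w p <= gauss_term w p k)%E.
Proof.
have [kp|kp] := boolP (k \in msupp p); first exact: ge_bigmin_seq.
by rewrite /gauss_term (memN_msupp_eq0 kp) v0 addye ?leey // mono_weightNy.
Qed.

Lemma le_gauss p (a : \bar R) :
  (forall k, (a <= gauss_term w p k)%E) -> (a <= gauss w p)%E.
Proof. by move=> H; apply: le_bigmine => k _. Qed.

Lemma gaussNy p : gauss w p != -oo%E.
Proof.
have [fin|//] := eqVneq (gauss w p) -oo%E.
have [|k _] := @bigmine_attained R _ (msupp p) (gauss_term w p).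
  by rewrite -/(gauss w p) fin.
by rewrite -/(gauss w p) fin => /eqP; rewrite (negbTE (gauss_termNy p k)).
Qed.

(* Several monomials may attain the minimum; the largest of them is kept, which
   makes leads multiplicative. *)
Definition is_lead p l := gauss_term w p l = gauss w p /\
  forall k, (l < k)%O -> (gauss w p < gauss_term w p k)%E.

Lemma is_lead_ex p : (gauss w p < +oo)%E -> exists l, is_lead p l.
Proof.
move=> fin; pose s := [seq k <- msupp p | gauss_term w p k == gauss w p].
have [|l ls lm] := @seq_has_max _ _ s.
  have [k kp E] := bigmine_attained fin.
  by apply/eqP => s0; have := in_nil k; rewrite -s0 mem_filter kp E eqxx.
move: ls; rewrite mem_filter => /andP[/eqP lE lp]; exists l; split=> // k lk.
rewrite lt_neqAle gauss_le andbT eq_sym; apply/negP => kE.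
suff /lm : k \in s by rewrite leNgt lk.
rewrite mem_filter kE mcoeff_msupp /=; apply/negP => /eqP kp.
move: kE; rewrite /gauss_term kp v0 addye ?mono_weightNy // => /eqP H.
by rewrite -H in fin.
Qed.

Lemma gauss_termZ c p k : gauss_term w (c *: p) k = (v c + gauss_term w p k)%E.
Proof. by rewrite /gauss_term mcoeffZ vM addeA. Qed.

Lemma gaussD p q : (Order.min (gauss w p) (gauss w q) <= gauss w (p + q)%R)%E.
Proof.
apply: le_gauss => k; rewrite /gauss_term mcoeffD.
have [] := leP (v (mcoeff k p)) (v (mcoeff k q)) => h.
  apply: (@le_trans _ _ (gauss_term w p k)); first by rewrite ge_min gauss_le.
  by apply: leeD => //; case: vP => _ _ _ _ /(_ (mcoeff k p) (mcoeff k q)); rewrite min_l.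
apply: (@le_trans _ _ (gauss_term w q k)); first by rewrite ge_min gauss_le orbT.
by apply: leeD => //; case: vP => _ _ _ _ /(_ (mcoeff k p) (mcoeff k q)); rewrite min_r // ltW.
Qed.

Lemma gauss_term_fin_mono p k (a : \bar R) : gauss_term w p k = a -> (a < +oo)%E ->
  mono_weight w k \is a fin_num.
Proof.
move=> <-; rewrite /gauss_term => H; rewrite fin_numE mono_weightNy /=.
by apply: contraTneq H => ->; rewrite addey ?ltxx // vNy.
Qed.

(** At the monomial [l] only the summand [i0] reaches the bound [A], so nothing cancels there.
    Beyond [l] every summand stays strictly above [A]. Both multiplicativity and orthogonality of
    the Gauss valuation come from this. *)
Lemma gauss_dominant (I : eqType) (s : seq I) (c : I -> K) (g : I -> mpoly n K)
    (i0 : I) (l : multinom n) (A := (v (c i0) + gauss w (g i0))%E) :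
  uniq s -> i0 \in s -> (A < +oo)%E -> is_lead (g i0) l ->
  (forall i, i \in s -> (A <= v (c i) + gauss w (g i))%E) ->
  (forall i k, i \in s -> i != i0 -> (l <= k)%O ->
    (A < v (c i) + gauss_term w (g i) k)%E) ->
  gauss w (\sum_(i <- s) c i *: g i) = A /\
  is_lead (\sum_(i <- s) c i *: g i) l.
Proof.
move=> us si0 Aoo [lE lgt] Ale Alt; set F := \sum_(i <- s) _.
have termE k : gauss_term w F k =
    (v (\sum_(i <- s) mcoeff k (c i *: g i)) + mono_weight w k)%E.
  by rewrite /gauss_term /F raddf_sum.
(* A finite weight at [l] can be cancelled, which turns comparisons of terms into comparisons of
   coefficients. *)
have lfin : mono_weight w l \is a fin_num.
  apply: (@gauss_term_fin_mono (g i0) _ _ lE).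
  by rewrite ltNge leye_eq; apply: contraTN Aoo => /eqP; rewrite /A => ->; rewrite addey ?ltxx // vNy.
have lF : gauss_term w F l = A.
  rewrite termE (valuation_sum_dominant (i := i0) vP us si0).
  - by rewrite mcoeffZ vM -addeA -/(gauss_term w (g i0) l) lE.
  - rewrite -(lteD2rE _ _ lfin) // mcoeffZ vM -addeA -/(gauss_term w (g i0) l) lE.
    by rewrite addye ?mono_weightNy.
  - move=> j sj ji; rewrite -(lteD2rE _ _ lfin) !mcoeffZ !vM -!addeA.
    by rewrite -!/(gauss_term w _ l) lE; apply: Alt.
have leF : (A <= gauss w F)%E.
  rewrite /F big_seq; elim/big_ind: _ => [|x y ax ay|i si].
  - by apply: le_gauss => k; rewrite /gauss_term mcoeff0 v0 addye ?leey ?mono_weightNy.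
  - by apply: le_trans (gaussD _ _); rewrite le_min ax.
  - apply: le_gauss => k; rewrite gauss_termZ; apply: le_trans (Ale i si) _.
    by rewrite leeD // gauss_le.
have FA : gauss w F = A.
  by apply/eqP; rewrite eq_le leF andbT -lF gauss_le.
split=> //; split; first by rewrite FA.
move=> k lk; rewrite FA termE.
have [kfin|] := boolP (mono_weight w k \is a fin_num); last first.
  rewrite fin_numE mono_weightNy /= negbK => /eqP ->.
  by rewrite addey.
rewrite -lteBlDr //; apply: valuation_sum_gt => //.
  by rewrite lteBlDr // addye ?mono_weightNy.
move=> i si; rewrite lteBlDr // mcoeffZ vM -addeA -/(gauss_term w (g i) k).
have [->|ne] := eqVneq i i0; last exact: Alt (ltW lk).
rewrite /A lteD2lE ?lgt // fin_numE vNy /=.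
by apply: contraTneq Aoo => H; rewrite /A H addye ?ltxx ?gaussNy.
Qed.

End Gauss.

Lemma adde_minr (R : realType) : right_distributive (@adde R) mine.
Proof.
move=> x y z; have [yz|/ltW zy] := leP y z.
  by rewrite min_l // leeD2l.
by rewrite min_r // leeD2l.
Qed.

(** * Multiplicativity of Gauss valuations and orthogonality of distinct leads *)

Section GaussValuation.
Variables (R : realType) (K : fieldType) (v : K -> \bar R).
Hypothesis vP : ring_valuation v.
Variable n : nat.
Variable w : 'I_n -> \bar R.
Hypothesis wNy : forall i, w i != -oo%E.
Implicit Types (k l : multinom n) (p q : mpoly n K).

Let vNy f : v f != -oo%E. Proof. by case: vP. Qed.
Let v0 : v 0 = +oo%E. Proof. by case: vP. Qed.
Let v1 : v 1 = 0%E. Proof. by case: vP. Qed.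
Let vM f g : v (f * g) = (v f + v g)%E. Proof. by case: vP. Qed.

Lemma gauss0 : gauss v w 0 = +oo%E.
Proof. by rewrite /gauss msupp0 big_nil. Qed.

Lemma gaussXM q k : gauss v w (q * mpolyX K k) = (mono_weight w k + gauss v w q)%E.
Proof.
rewrite /gauss (perm_big _ (msuppMX _ _)) big_map.
under eq_bigr do rewrite /gauss_term mcoeffMX mono_weightD addeCA.
rewrite -(@big_morph _ _ (adde (mono_weight w k)) +oo%E mine +oo%E mine) //.
- by move=> x y; rewrite adde_minr.
- by apply: addey; rewrite mono_weightNy.
Qed.

Lemma gauss_termXM q k l :
  gauss_term v w (q * mpolyX K k) (mnm_add k l) =
  (mono_weight w k + gauss_term v w q l)%E.
Proof. by rewrite /gauss_term mcoeffMX mono_weightD addeCA. Qed.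

Lemma gaussX k : gauss v w (mpolyX K k) = mono_weight w k.
Proof.
by rewrite /gauss msuppX big_seq1 /gauss_term mcoeffX eqxx v1 add0e.
Qed.

Lemma gaussC (c : K) : gauss v w (mpolyC n c) = v c.
Proof.
rewrite /gauss msuppC; have [->|c0] := eqVneq c 0; first by rewrite big_nil v0.
by rewrite big_seq1 /gauss_term mcoeffC eqxx mulr1 mono_weight0 adde0.
Qed.

Lemma gaussZ (c : K) p : gauss v w (c *: p) = (v c + gauss v w p)%E.
Proof.
have [->|c0] := eqVneq c 0.
  by rewrite scale0r v0 gauss0 addye // gaussNy.
rewrite /gauss (perm_big _ (msuppZ p c0)).
under eq_bigr do rewrite (gauss_termZ vP).
rewrite -(@big_morph _ _ (adde (v c)) +oo%E mine +oo%E mine) //.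
- by move=> x y; rewrite adde_minr.
- exact: addey.
Qed.

Lemma gauss_sum_ge (I : eqType) (s : seq I) (F : I -> mpoly n K) (a : \bar R) :
  (forall i, i \in s -> (a <= gauss v w (F i))%E) ->
  (a <= gauss v w (\sum_(i <- s) F i)%R)%E.
Proof.
move=> H; rewrite big_seq; elim/big_ind: _ => [|x y ax ay|i /H //].
  by rewrite gauss0 leey.
by apply: le_trans (gaussD vP wNy _ _); rewrite le_min ax.
Qed.

Lemma mpolyM_mono p q :
  p * q = \sum_(k <- msupp p) mcoeff k p *: (q * mpolyX K k).
Proof.
rewrite {1}(mpolyE p) mulr_suml; apply: eq_bigr => k _.
by rewrite -scalerAl mulrC.
Qed.

Lemma gaussM_ge p q : (gauss v w p + gauss v w q <= gauss v w (p * q)%R)%E.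
Proof.
rewrite mpolyM_mono; apply: gauss_sum_ge => k kp.
by rewrite gaussZ gaussXM addeA; apply: leeD => //; exact: gauss_le.
Qed.

(** Expand [p] only, as a sum of multiples of [q] by the monomials of [p]; the multiple by [lp] is
    the dominant summand. *)
Lemma gaussM_lead p q lp lq :
  (gauss v w p < +oo)%E -> (gauss v w q < +oo)%E ->
  is_lead v w p lp -> is_lead v w q lq ->
  gauss v w (p * q) = (gauss v w p + gauss v w q)%E /\
  is_lead v w (p * q) (mnm_add lp lq).
Proof.
move=> poo qoo [pE pgt] [qE qgt].
have pfin : gauss v w p \is a fin_num by rewrite fin_numE gaussNy //= lt_eqF.
have qfin : gauss v w q \is a fin_num by rewrite fin_numE gaussNy //= lt_eqF.
have lpfin := gauss_term_fin_mono vP wNy pE poo.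
have AE : (v (mcoeff lp p) + gauss v w (q * mpolyX K lp)%R =
           gauss v w p + gauss v w q)%E.
  by rewrite gaussXM addeA -pE.
rewrite mpolyM_mono -AE; apply: gauss_dominant => //.
- rewrite mcoeff_msupp; apply: contraTneq poo => lp0.
  by rewrite -pE /gauss_term lp0 v0 addye ?ltxx // mono_weightNy.
- by rewrite AE lte_add_pinfty.
- have XMoo : (gauss v w (q * mpolyX K lp)%R < +oo)%E.
    by rewrite gaussXM lte_add_pinfty // ltey_eq lpfin.
  split=> [|k lk]; first by rewrite gauss_termXM qE gaussXM.
  have [k0|] := boolP (k \in msupp (q * mpolyX K lp)); last first.
    move=> /memN_msupp_eq0 k0.
    by rewrite /gauss_term k0 v0 addye // mono_weightNy.
  move: k0 lk; rewrite (perm_mem (msuppMX _ _)) => /mapP[l _ ->].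
  by rewrite ltmc_add2r gaussXM gauss_termXM => /qgt ?; rewrite lteD2lE.
- move=> k kp; rewrite AE gaussXM addeA; apply: leeD => //.
  exact: gauss_le.
- move=> k l kp klp lel; rewrite AE.
  have [l0|] := boolP (l \in msupp (q * mpolyX K k)); last first.
    move=> /memN_msupp_eq0 l0.
    rewrite /gauss_term l0 v0 addye ?mono_weightNy // addey //.
    by rewrite lte_add_pinfty.
  move: l0 lel; rewrite (perm_mem (msuppMX _ _)) => /mapP[l' _ ->] lel.
  rewrite gauss_termXM addeA -/(gauss_term v w p k).
  (* Here [lp + lq <= k + l']. If [k < lp], then [lq < l'] and the term of [q] is too large; if
     [lp < k], the term of [p] is. *)
  have [ltk|ltk|eqk] := ltgtP k lp.
  + have lt' : (lq < l')%O.
      rewrite ltNge; apply: contraTN lel => l'q; rewrite -ltNge.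
      exact: ltmc_le_add.
    by apply: lee_ltD => //; [exact: gauss_le|exact: qgt].
  + by apply: lte_leD => //; [exact: pgt|exact: gauss_le].
  + by rewrite eqk eqxx in klp.
Qed.

Lemma gaussM p q : gauss v w (p * q) = (gauss v w p + gauss v w q)%E.
Proof.
have [poo|] := ltP (gauss v w p) +oo%E; last first.
  rewrite leye_eq => /eqP pE; apply/eqP; rewrite eq_le gaussM_ge andbT.
  by rewrite pE addye ?leey // gaussNy.
have [qoo|] := ltP (gauss v w q) +oo%E; last first.
  rewrite leye_eq => /eqP qE; apply/eqP; rewrite eq_le gaussM_ge andbT.
  by rewrite qE addey ?leey // gaussNy.
have [lp pP] := is_lead_ex vP wNy poo; have [lq qP] := is_lead_ex vP wNy qoo.
by have [] := gaussM_lead poo qoo pP qP.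
Qed.

Lemma gauss_valuation : ring_valuation (gauss v w).
Proof.
split=> //.
- exact: gaussNy.
- exact: gauss0.
- by rewrite -mpolyC1 gaussC.
- exact: gaussM.
- exact: gaussD.
Qed.

Lemma is_leadX k : (mono_weight w k < +oo)%E -> is_lead v w (mpolyX K k) k.
Proof.
move=> koo; rewrite /is_lead gaussX /gauss_term mcoeffX eqxx v1 add0e; split=> // l kl.
by rewrite mcoeffX lt_eqF // v0 addye // mono_weightNy.
Qed.

Lemma is_lead_prod (I : Type) (s : seq I) (P : pred I) (F : I -> mpoly n K)
    (l : I -> multinom n) :
  (forall i, P i -> (gauss v w (F i) < +oo)%E /\ is_lead v w (F i) (l i)) ->
  (gauss v w (\prod_(i <- s | P i) F i)%R < +oo)%E /\
  is_lead v w (\prod_(i <- s | P i) F i) (\big[mnm_add/mnm0]_(i <- s | P i) l i).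
Proof.
move=> H; elim/big_rec2: _ => [|i k p Pi [poo pl]].
  rewrite -mpolyX0 gaussX mono_weight0 ltry; split=> //.
  by apply: is_leadX; rewrite mono_weight0 ltry.
have [ioo il] := H i Pi; have [E lE] := gaussM_lead ioo poo il pl.
by rewrite E; split=> //; rewrite lte_add_pinfty.
Qed.

(** Among the summands that attain the minimum, the one with the largest lead [l i0] is dominant:
    the others have strictly smaller leads, hence strictly larger terms from [l i0] on. *)
Lemma gauss_ortho (I : eqType) (s : seq I) (c : I -> K) (g : I -> mpoly n K)
    (l : I -> multinom n) :
  uniq s ->
  (forall i, i \in s -> (gauss v w (g i) < +oo)%E -> is_lead v w (g i) (l i)) ->
  (forall i j, i \in s -> j \in s -> (gauss v w (g i) < +oo)%E ->
     (gauss v w (g j) < +oo)%E -> l i = l j -> i = j) ->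
  gauss v w (\sum_(i <- s) c i *: g i) =
  (\big[mine/+oo]_(i <- s) (v (c i) + gauss v w (g i)))%E.
Proof.
move=> us ld inj; set A := (\big[mine/+oo]_(i <- s) _)%E.
have Ale i : i \in s -> (A <= v (c i) + gauss v w (g i))%E.
  by move=> si; exact: (@ge_bigmin_seq _ _ _ _ _ i xpredT (fun i => v (c i) + gauss v w (g i))%E).
have leA : (A <= gauss v w (\sum_(i <- s) c i *: g i)%R)%E.
  by apply: gauss_sum_ge => i si; rewrite gaussZ Ale.
have [Aoo|] := ltP A +oo%E; last first.
  by rewrite leye_eq => /eqP E; apply/eqP; rewrite eq_le leA andbT E leey.
pose s' := [seq l i | i <- s & (v (c i) + gauss v w (g i))%E == A].
have [|_ /mapP[i0 + ->] maxl] := @seq_has_max _ _ s'.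
  have [i si E] := bigmine_attained Aoo.
  apply/eqP => s0; have := in_nil (l i); rewrite -s0 map_f //.
  by rewrite mem_filter si E eqxx.
rewrite mem_filter => /andP[/eqP i0A si0].
have goo i : (v (c i) + gauss v w (g i))%E = A -> (gauss v w (g i) < +oo)%E.
  by move=> E; rewrite ltNge leye_eq; apply: contraTN Aoo => /eqP H; rewrite -E H addey ?ltxx.
have [] // := gauss_dominant vP wNy (c := c) (g := g) (i0 := i0) (l := l i0) us si0.
- by rewrite i0A.
- by apply: ld => //; exact: goo.
- by move=> i /Ale; rewrite i0A.
- move=> i k si ii0 lk; rewrite i0A.
  have [iA|] := eqVneq (v (c i) + gauss v w (g i))%E A; last first.
    rewrite eq_sym => ne; apply: (@lt_le_trans _ _ (v (c i) + gauss v w (g i))%E).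
      by rewrite lt_neqAle ne Ale.
    by rewrite leeD // gauss_le.
  have lt : (l i < k)%O.
    apply: lt_le_trans lk; rewrite lt_neqAle maxl ?andbT; last first.
      by apply: map_f; rewrite mem_filter iA eqxx.
    by apply: contra ii0 => /eqP /inj; rewrite si si0 !goo //; move=> ->.
  have [_ /(_ _ lt)] := ld i si (goo _ iA).
  rewrite -iA lteD2lE // fin_numE vNy /=.
  by apply: contraTneq Aoo => H; rewrite -iA H addye ?ltxx // gaussNy.
by move=> ->; rewrite i0A.
Qed.

End GaussValuation.

(** * Noncrossing monomials *)

(* The permutation [s] places the leaf [i] at position [s i] of a line. *)
Section Arcs.
Variables (m : nat) (s : {perm 'I_m}).
Implicit Types (e f : ordpair m) (M N : multinom #|{: ordpair m}|).

Definition arc_lo e : nat := minn (s (val e).1) (s (val e).2).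
Definition arc_hi e : nat := maxn (s (val e).1) (s (val e).2).

Definition crossing e f := (arc_lo e < arc_lo f < arc_hi e)%N && (arc_hi e < arc_hi f)%N.

Definition arc_mult M e : nat := M (enum_rank e).

Definition noncrossing M := forall e f,
  (0 < arc_mult M e)%N -> (0 < arc_mult M f)%N -> ~~ crossing e f.

Lemma arc_ends_neq e : s (val e).1 != s (val e).2 :> nat.
Proof.
rewrite (inj_eq val_inj) (inj_eq perm_inj); apply: contraTneq (valP e) => ->.
by rewrite ltnn.
Qed.

Lemma arc_lo_hi e : (arc_lo e < arc_hi e)%N.
Proof. by have := arc_ends_neq e; rewrite /arc_lo /arc_hi; lia. Qed.

Lemma arc_hi_bound e : (arc_hi e < m)%N.
Proof.
by rewrite /arc_hi gtn_max !ltn_ord.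
Qed.

Lemma arc_lo_hi_inj e f : arc_lo e = arc_lo f -> arc_hi e = arc_hi f -> e = f.
Proof.
move=> lo_ef hi_ef; have := valP e; have := valP f; rewrite /= => f12 e12.
have [[e1 e2]|[e1 e2]] :
    ((s (val e).1 = s (val f).1 :> nat) /\ (s (val e).2 = s (val f).2 :> nat)) \/
    ((s (val e).1 = s (val f).2 :> nat) /\ (s (val e).2 = s (val f).1 :> nat)).
- by move: lo_ef hi_ef; rewrite /arc_lo /arc_hi; lia.
- apply: val_inj; move/val_inj/perm_inj: e1; move/val_inj/perm_inj: e2.
  by case: (val e) (val f) => [? ?] [? ?] /= -> ->.
move/val_inj/perm_inj: e1 => e1; move/val_inj/perm_inj: e2 => e2.
by move: e12; rewrite e1 e2 ltnNge ltnW.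
Qed.

Lemma arc_multD M N e : arc_mult (mnm_add M N) e = (arc_mult M e + arc_mult N e)%N.
Proof. exact: mnmDE. Qed.

Lemma arc_mult1 e f : arc_mult (mnm1 (enum_rank e)) f = (e == f).
Proof. by rewrite /arc_mult mnm1E (inj_eq enum_rank_inj). Qed.

Lemma arc_mult_eq M N : (forall e, arc_mult M e = arc_mult N e) -> M = N.
Proof.
by move=> H; apply/mnmP => i; rewrite -(enum_valK i); exact: (H (enum_val i)).
Qed.

Lemma arc_mult_rem M e : (0 < arc_mult M e)%N ->
  exists M0, M = mnm_add M0 (mnm1 (enum_rank e)).
Proof.
move=> Me; exists (mnm_sub M (mnm1 (enum_rank e))); apply/mnmP => i.
rewrite mnmDE mnmBE mnm1E subnK //; case: eqP => // <-; exact: Me.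
Qed.

Lemma noncrossing_sub M N : noncrossing (mnm_add M N) -> noncrossing M.
Proof.
by move=> H e f Me Mf; apply: H; rewrite arc_multD ltn_addr.
Qed.

(** The weight of the monomial for the [i]-th torus factor, and the exponent of the [i]-th scale in
    its lead. *)
Definition arc_degree M (i : 'I_m) : nat :=
  (\sum_e arc_mult M e * (((val e).1 == i) + ((val e).2 == i)))%N.

Lemma arc_degreeP M (i : 'I_m) : (0 < arc_degree M i)%N <->
  exists2 e, (0 < arc_mult M e)%N & (s i = arc_lo e :> nat \/ s i = arc_hi e :> nat).
Proof.
have E e : (0 < ((val e).1 == i) + ((val e).2 == i))%N <->
    (s i = arc_lo e :> nat \/ s i = arc_hi e :> nat).
  have H j : (j == i) = (s j == s i :> nat).
    by rewrite (inj_eq val_inj) (inj_eq perm_inj).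
  rewrite !H /arc_lo /arc_hi; split; last by lia.
  by case: eqP => [<- _|_]; [lia|case: eqP => // <- _; lia].
rewrite lt0n sum_nat_eq0; split.
  move=> /forallPn[e]; rewrite -lt0n muln_gt0 => /andP[Me /E ?].
  by exists e.
move=> [e Me /E ei]; apply/forallPn; exists e.
by rewrite -lt0n muln_gt0 Me.
Qed.

End Arcs.

(** * Recovering a noncrossing monomial from its degrees and top counts *)

Section Uniqueness.
Variables (m : nat) (s : {perm 'I_m}) (d : Order.disp_t) (O : orderType d).
Variables (key : 'I_m -> O) (top : ordpair m -> 'I_m).
Hypothesis key_inj : injective key.
Hypothesis top_in : forall e, (arc_lo s e <= top e < arc_hi s e)%N.
Hypothesis top_min : forall e (q : 'I_m),
  (arc_lo s e <= q < arc_hi s e)%N -> (key (top e) <= key q)%O.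
Implicit Types (e f : ordpair m) (M N : multinom #|{: ordpair m}|).

(** When [top e] is the minimal gap of the arc [e], this is the exponent of the gap [q] in the lead
    of the monomial. *)
Definition top_count M (q : 'I_m) : nat := (\sum_e arc_mult M e * (top e == q))%N.

Lemma top_countP M q : (0 < top_count M q)%N <->
  exists2 e, (0 < arc_mult M e)%N & top e = q.
Proof.
rewrite lt0n sum_nat_eq0; split.
  move=> /forallPn[e]; rewrite -lt0n muln_gt0 lt0b => /andP[Me /eqP ?].
  by exists e.
move=> [e Me ei]; apply/forallPn; exists e.
by rewrite -lt0n muln_gt0 Me ei eqxx.
Qed.

(* The ends of this arc are the leaves in use that are nearest to [p] on either
   side, so the degrees and the top counts determine it. *)
Lemma shortest_last_arc M p : noncrossing s M -> (0 < top_count M p)%N ->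
  (forall q, (0 < top_count M q)%N -> (key q <= key p)%O) ->
  exists e, [/\ (0 < arc_mult M e)%N, top e = p &
    forall f, (0 < arc_mult M f)%N ->
      ~~ (arc_lo s e < arc_lo s f < arc_hi s e)%N /\
      ~~ (arc_lo s e < arc_hi s f < arc_hi s e)%N].
Proof.
move=> ncM /top_countP[e0 Me0 te0] pmax.
pose Q := [pred e | (0 < arc_mult M e)%N && (top e == p)].
have Qe0 : Q e0 by rewrite /= Me0 te0 eqxx.
case: (@arg_minnP _ e0 Q (fun e => arc_hi s e - arc_lo s e)%N Qe0) => e /andP[Me /eqP te] emin.
exists e; split=> // f Mf.
(* Since [f] crosses [e] in neither direction, an end of [f] inside [e] forces [f] to be nested in
   [e]. A nested arc has a top of key at least that of [p], hence top [p] by maximality, and it is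
   shorter than [e]. *)
suff H : (arc_lo s e <= arc_lo s f)%N -> (arc_hi s f <= arc_hi s e)%N ->
    (arc_lo s e < arc_lo s f)%N || (arc_hi s f < arc_hi s e)%N -> False.
  have := ncM e f Me Mf; have := ncM f e Mf Me; rewrite /crossing.
  have := arc_lo_hi s e; have := arc_lo_hi s f.
  by split; apply/negP => h; apply: H; lia.
move=> lo_ef hi_ef ne.
have Qf : Q f.
  rewrite /= Mf; apply/eqP/key_inj/eqP; rewrite eq_le pmax /=; last first.
    by apply/top_countP; exists f.
  by rewrite -te top_min //; have := top_in f; lia.
by have := emin f Qf; have := arc_lo_hi s f; lia.
Qed.

(** Induction on the degree: the arcs that [shortest_last_arc] finds in [M] and in [N] for the
    largest top coincide, and one copy is removed from each. *)
Lemma noncrossing_unique M N : noncrossing s M -> noncrossing s N ->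
  (forall i, arc_degree M i = arc_degree N i) ->
  (forall q, top_count M q = top_count N q) -> M = N.
Proof.
have [k] := ubnP (mdeg M); elim: k M N => // k IH M N Mk ncM ncN degE topE.
have [[p0 Mp0]|none] := pselect (exists p, (0 < top_count M p)%N); last first.
  have z (M' : multinom _) : (forall q, top_count M' q = top_count M q) ->
      forall e, arc_mult M' e = 0%N.
    move=> H e; apply/eqP; rewrite -leqn0 leqNgt; apply/negP => Me; apply: none.
    by exists (top e); rewrite -H; apply/top_countP; exists e.
  by apply: arc_mult_eq => e; rewrite !z.
case: (@arg_maxP _ _ _ p0 [pred q | (0 < top_count M q)%N] key Mp0) => /= p Mp pmax.
have [e [Me te eM]] := shortest_last_arc ncM Mp pmax.
have [f [Nf tf fN]] : exists e, [/\ (0 < arc_mult N e)%N, top e = p &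
    forall f, (0 < arc_mult N f)%N ->
      ~~ (arc_lo s e < arc_lo s f < arc_hi s e)%N /\
      ~~ (arc_lo s e < arc_hi s f < arc_hi s e)%N].
  by apply: shortest_last_arc => // [|q]; rewrite -topE // => /pmax.
have leaf a : (a < m)%N -> exists i, s i = a :> nat.
  by move=> am; exists ((s^-1)%g (Ordinal am)); rewrite permKV.
(* Equal degrees mean that the arcs of both monomials end at the same leaves. *)
have transfer (M1 M2 : multinom _) g a :
    (forall i, arc_degree M1 i = arc_degree M2 i) -> (0 < arc_mult M1 g)%N ->
    (a = arc_lo s g \/ a = arc_hi s g) -> exists2 h, (0 < arc_mult M2 h)%N &
    (a = arc_lo s h \/ a = arc_hi s h).
  move=> H M1g ag; have [|i sia] := leaf a.
    by have := arc_lo_hi s g; have := arc_hi_bound s g; case: ag => ->; lia.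
  have : (0 < arc_degree M1 i)%N.
    by apply/(arc_degreeP s); exists g => //; rewrite sia.
  by rewrite H => /(arc_degreeP s)[h M2h]; rewrite sia => ?; exists h.
have te_in := top_in e; have tf_in := top_in f; rewrite te in te_in; rewrite tf in tf_in.
have outM a : (a = arc_lo s f \/ a = arc_hi s f) -> ~~ (arc_lo s e < a < arc_hi s e)%N.
  by move=> /(transfer N M f a (fun i => esym (degE i)) Nf)[h /eM[h1 h2]] [->|->].
have outN a : (a = arc_lo s e \/ a = arc_hi s e) -> ~~ (arc_lo s f < a < arc_hi s f)%N.
  by move=> /(transfer M N e a degE Me)[h /fN[h1 h2]] [->|->].
(* Both arcs contain the gap [p], and neither has an end strictly inside the other. *)
have ef : e = f.
  have := outM _ (or_introl erefl); have := outM _ (or_intror erefl).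
  have := outN _ (or_introl erefl); have := outN _ (or_intror erefl).
  by move=> h1 h2 h3 h4; apply: (@arc_lo_hi_inj _ s); lia.
move: Nf; rewrite -ef => Ne.
have [M0 ME] := arc_mult_rem Me; have [N0 NE] := arc_mult_rem Ne.
have degD (A : multinom _) i :
    arc_degree (mnm_add A (mnm1 (enum_rank e))) i =
    (arc_degree A i + arc_degree (mnm1 (enum_rank e)) i)%N.
  by rewrite -big_split; apply: eq_bigr => g _; rewrite arc_multD mulnDl.
have topD (A : multinom _) q :
    top_count (mnm_add A (mnm1 (enum_rank e))) q =
    (top_count A q + top_count (mnm1 (enum_rank e)) q)%N.
  by rewrite -big_split; apply: eq_bigr => g _; rewrite arc_multD mulnDl.
rewrite ME NE (IH M0 N0) //.
- by move: Mk; rewrite ME mdegD mdeg1 addn1.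
- by move: ncM; rewrite ME; exact: noncrossing_sub.
- by move: ncN; rewrite NE; exact: noncrossing_sub.
- by move=> i; have := degE i; rewrite ME NE !degD => /addIn.
- by move=> q; have := topE q; rewrite ME NE !topD => /addIn.
Qed.

End Uniqueness.

(** * Straightening *)

Section Straightening.
Variables (K : fieldType) (m : nat).
Implicit Types (i j k l : 'I_m) (e f : ordpair m) (p q : coord_poly K m).

Definition arc_var e : coord_poly K m := mpolyX K (mnm1 (enum_rank e)).

(* The antisymmetric extension of the coordinates [x_ij] to all [i], [j]. *)
Definition plucker i j : coord_poly K m :=
  if insub (i, j) is Some e then arc_var e
  else if insub (j, i) is Some e then - arc_var e else 0.

Lemma ring_pi_eq p q :
  (forall x, cone_Gr2 x -> coord_eval x p = coord_eval x q) ->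
  \pi_(coord_ring K m)%qT p = \pi_(coord_ring K m)%qT q.
Proof.
by move=> H; apply: coord_ring_ext => x xX; rewrite !ring_eval_pi // H.
Qed.

Lemma coord_eval_arc_var x e : coord_eval x (arc_var e) = x e.
Proof. by rewrite /coord_eval mevalXU enum_rankK. Qed.

Lemma coord_evalE x : coord_eval (K := K) (m := m) x =
  meval (fun u => x (enum_val u)).
Proof. by []. Qed.

Lemma coord_eval_plucker (y z : 'I_m -> K) x i j :
  (forall e, x e = y (val e).1 * z (val e).2 - y (val e).2 * z (val e).1) ->
  coord_eval x (plucker i j) = y i * z j - y j * z i.
Proof.
move=> xE; rewrite /plucker; case: insubP => [e _ eE|nij].
  by rewrite coord_eval_arc_var xE eE.
case: insubP => [e _ eE|nji].
  by rewrite coord_evalE mevalN -coord_evalE coord_eval_arc_var xE eE opprB.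
rewrite coord_evalE meval0; suff -> : i = j by rewrite subrr.
by apply: val_inj => /=; move: nij nji => /=; lia.
Qed.

Lemma plucker_relation i j k l :
  \pi_(coord_ring K m)%qT (plucker i k * plucker j l) =
  \pi_(coord_ring K m)%qT (plucker i j * plucker k l + plucker i l * plucker j k).
Proof.
apply: ring_pi_eq => x [y [z xE]].
rewrite !coord_evalE mevalD !mevalM -!coord_evalE !(coord_eval_plucker _ _ xE).
ring.
Qed.

Lemma plucker_arc (s : {perm 'I_m}) i j : i != j ->
  exists e b, [/\ plucker i j = (-1) ^+ b *: arc_var e,
    arc_lo s e = minn (s i) (s j) & arc_hi s e = maxn (s i) (s j)].
Proof.
move=> ij; rewrite /plucker; case: insubP => [e _ eE|nij].
  by exists e, 0%N; rewrite expr0 scale1r /arc_lo /arc_hi eE.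
case: insubP => [e _ eE|nji].
  by exists e, 1%N; rewrite expr1 scaleN1r /arc_lo /arc_hi eE minnC maxnC.
by case/eqP: ij; apply: val_inj => /=; move: nij nji => /=; lia.
Qed.

Lemma arc_plucker (s : {perm 'I_m}) e : exists i j b,
  [/\ arc_var e = (-1) ^+ b *: plucker i j, s i = arc_lo s e :> nat &
      s j = arc_hi s e :> nat].
Proof.
have eE : insub (val e) = Some e by exact: valK.
have eN : insub ((val e).2, (val e).1) = None :> option (ordpair m).
  by apply: insubN => /=; rewrite -leqNgt ltnW //; exact: (valP e).
have pE : val e = ((val e).1, (val e).2) by case: (val e).
have [lt|gt|eq] := ltngtP (s (val e).1) (s (val e).2).
- exists (val e).1, (val e).2, 0%N.
  by rewrite /plucker -pE eE expr0 scale1r /arc_lo /arc_hi; split=> //; lia.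
- exists (val e).2, (val e).1, 1%N.
  by rewrite /plucker -pE eE eN expr1 scaleN1r opprK /arc_lo /arc_hi; split=> //; lia.
- by move: (arc_ends_neq s e); rewrite eq eqxx.
Qed.

Variable s : {perm 'I_m}.

Definition noncrossing_poly p := forall M, M \in msupp p -> noncrossing s M.

Lemma noncrossing_polyD p q :
  noncrossing_poly p -> noncrossing_poly q -> noncrossing_poly (p + q).
Proof.
by move=> np nq M /msuppD_le; rewrite mem_cat => /orP[/np|/nq].
Qed.

Lemma noncrossing_polyZ c p : noncrossing_poly p -> noncrossing_poly (c *: p).
Proof. by move=> np M /msuppZ_le /np. Qed.

(* Concave in the length of the arc, so that uncrossing two arcs decreases it. *)
Definition arc_cost e : nat :=
  ((arc_hi s e - arc_lo s e) * (m - (arc_hi s e - arc_lo s e)))%N.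

Definition mono_cost (M : multinom #|{: ordpair m}|) : nat :=
  (\sum_e arc_mult M e * arc_cost e)%N.

Lemma mono_costD M N : mono_cost (mnm_add M N) = (mono_cost M + mono_cost N)%N.
Proof. by rewrite -big_split; apply: eq_bigr => e _; rewrite arc_multD mulnDl. Qed.

Lemma mono_cost1 e : mono_cost (mnm1 (enum_rank e)) = arc_cost e.
Proof.
rewrite /mono_cost (bigD1 e) //= arc_mult1 eqxx mul1n big1 ?addn0 // => f fe.
by rewrite arc_mult1 eq_sym (negbTE fe).
Qed.

Let piD : {morph \pi_(coord_ring K m)%qT : p q / p + q}.
Proof. exact: pi_addr. Qed.

Let piM : {morph \pi_(coord_ring K m)%qT : p q / p * q}.
Proof. exact: pi_mulr. Qed.

Let piZ c p q : \pi_(coord_ring K m)%qT p = \pi_(coord_ring K m)%qT q ->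
  \pi_(coord_ring K m)%qT (c *: p) = \pi_(coord_ring K m)%qT (c *: q).
Proof. by rewrite -!mul_mpolyC !piM => ->. Qed.

(** For leaves in the order [i], [j], [k], [l], the three-term Plücker relation trades the crossing
    arcs [ik], [jl] for the pairs [ij], [kl] and [il], [jk]. *)
Lemma uncross e f : crossing s e f -> exists (c c' : K) e1 e2 f1 f2,
  [/\ \pi_(coord_ring K m)%qT (arc_var e * arc_var f) =
      \pi_(coord_ring K m)%qT (c *: (arc_var e1 * arc_var e2) +
                               c' *: (arc_var f1 * arc_var f2)),
      (arc_cost e1 + arc_cost e2 < arc_cost e + arc_cost f)%N &
      (arc_cost f1 + arc_cost f2 < arc_cost e + arc_cost f)%N].
Proof.
have [i [k [b [eE si sk]]]] := arc_plucker s e.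
have [j [l [b' [fE sj sl]]]] := arc_plucker s f.
rewrite /crossing /arc_cost -si -sk -sj -sl => /andP[/andP[ij jk] kl].
have sm := ltn_ord (s l).
have neq (a c : 'I_m) : (s a < s c)%N -> a != c.
  by move=> h; apply: contraTneq h => ->; rewrite ltnn.
have [e1 [b1 [E1 lo1 hi1]]] := @plucker_arc s i j (neq _ _ ij).
have [e2 [b2 [E2 lo2 hi2]]] := @plucker_arc s k l (neq _ _ kl).
have [|f1 [b3 [F1 lo3 hi3]]] := @plucker_arc s i l; first by apply: neq; lia.
have [f2 [b4 [F2 lo4 hi4]]] := @plucker_arc s j k (neq _ _ jk).
exists ((-1) ^+ (b + b' + b1 + b2)), ((-1) ^+ (b + b' + b3 + b4)), e1, e2, f1, f2.
split.
- rewrite eE fE -scalerAl -scalerAr scalerA.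
  rewrite (piZ _ (plucker_relation i j k l)) E1 E2 F1 F2; congr (\pi_(_) _)%qT.
  rewrite -!scalerAl -!scalerAr !scalerA scalerDr !scalerA.
  by rewrite -!exprD !addnA.
- rewrite lo1 hi1 lo2 hi2 (minn_idPl (ltnW ij)) (maxn_idPr (ltnW ij)).
  rewrite (minn_idPl (ltnW kl)) (maxn_idPr (ltnW kl)).
  (* In terms of positions the cost drops by [2 (k - j) (m - (l - i))], which is positive because
     positions are below [m]. *)
  by move: ij jk kl sm; clear; nia.
- have il : (s i <= s l)%N by lia.
  rewrite lo3 hi3 lo4 hi4 (minn_idPl il) (maxn_idPr il).
  rewrite (minn_idPl (ltnW jk)) (maxn_idPr (ltnW jk)).
  (* Here the cost drops by [2 (j - i) (l - k)]. *)
  by move: ij jk kl sm; clear; nia.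
Qed.

Lemma straighten_mono M : exists F, noncrossing_poly F /\
  \pi_(coord_ring K m)%qT F = \pi_(coord_ring K m)%qT (mpolyX K M).
Proof.
have [k] := ubnP (mono_cost M); elim: k M => // k IH M Mk.
have [[e [f [Me Mf cef]]]|nc] := pselect (exists e f,
    [/\ (0 < arc_mult M e)%N, (0 < arc_mult M f)%N & crossing s e f]); last first.
  exists (mpolyX K M); split=> // N; rewrite msuppX inE => /eqP -> e f Me Mf.
  by apply/negP => cef; apply: nc; exists e, f.
(* An arc does not cross itself, so one copy of each of the two arcs can be split off from [M]. *)
have ef : e != f.
  by apply: contraTneq cef => ->; rewrite /crossing ltnn.
have [M1 ME] := arc_mult_rem Me.
have [|M0 M1E] := @arc_mult_rem _ M1 f.
  by move: Mf; rewrite ME arc_multD arc_mult1 (negbTE ef) addn0.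
have [c [c' [e1 [e2 [f1 [f2 [E cost_e cost_f]]]]]]] := uncross cef.
have IHs g h : (arc_cost g + arc_cost h < arc_cost e + arc_cost f)%N ->
    exists F, noncrossing_poly F /\ \pi_(coord_ring K m)%qT F =
      \pi_(coord_ring K m)%qT (mpolyX K M0 * (arc_var g * arc_var h)).
  move=> gh; have [|F [nF FE]] :=
    IH (mnm_add M0 (mnm_add (mnm1 (enum_rank g)) (mnm1 (enum_rank h)))).
    move: Mk; rewrite ME M1E !mono_costD !mono_cost1; lia.
  by exists F; split; rewrite // FE !mpolyXD.
have [F1 [nF1 F1E]] := IHs _ _ cost_e; have [F2 [nF2 F2E]] := IHs _ _ cost_f.
exists (c *: F1 + c' *: F2); split.
  by apply: noncrossing_polyD; exact: noncrossing_polyZ.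
have -> : mpolyX K M = mpolyX K M0 * (arc_var e * arc_var f).
  by rewrite ME M1E !mpolyXD -mulrA (mulrC (arc_var e)).
rewrite piM E -piM mulrDr !piD -!scalerAr.
by rewrite (piZ _ F1E) (piZ _ F2E).
Qed.

Lemma straighten p : exists F, noncrossing_poly F /\
  \pi_(coord_ring K m)%qT F = \pi_(coord_ring K m)%qT p.
Proof.
rewrite (mpolyE p); elim/big_ind: _ => [|q r [F [nF FE]] [G [nG GE]]|M _].
- by exists 0; split=> // M; rewrite msupp0.
- by exists (F + G); rewrite !piD FE GE; split=> //; exact: noncrossing_polyD.
- have [F [nF FE]] := straighten_mono M; exists (mcoeff M p *: F).
  by split; [exact: noncrossing_polyZ|exact: piZ].
Qed.

Lemma straighten_ring (g : coord_ring K m) :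
  exists F, noncrossing_poly F /\ \pi_(coord_ring K m)%qT F = g.
Proof. by elim/quotW: g => p; exact: straighten. Qed.

End Straightening.

(** * Points on a line in a given order *)

(** Distinct monomials are distinct characters of the torus, and these are linearly independent
    because [a] has infinite multiplicative order. *)
Lemma mpoly_vanishing (K : fieldType) (n : nat) (a : K) (p : mpoly n K) :
  a != 0 -> (forall k : int, a ^ k = 1 -> k = 0) ->
  (forall z : 'I_n -> K, meval z p = 0) -> p = 0.
Proof.
move=> a0 aoo pz; apply/mpolyP => M; rewrite mcoeff0.
have [Mp|/memN_msupp_eq0 //] := boolP (M \in msupp p).
pose W (N : multinom n) : weight n := [ffun i => (N i)%:Z].
have Winj : injective W.
  move=> N N' /ffunP E; apply/mnmP => i.
  by have := E i; rewrite !ffunE => -[].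
pose V (b : weight n) : multinom n := Multinom [tuple `|b i|%N | i < n].
have WK : cancel W V.
  by move=> N; apply/mnmP => i; rewrite mnmE ffunE absz_nat.
have := @characters_free K n a (map W (msupp p)) (fun b => mcoeff (V b) p) a0 aoo.
rewrite (map_inj_uniq Winj) msupp_uniq => /(_ isT) H.
rewrite -(WK M) H ?map_f // => t _; rewrite big_map -[RHS](pz t) mevalE.
by apply: eq_bigr => N _; rewrite WK mulrC; congr (_ * _); apply: eq_bigr => i _; rewrite ffunE.
Qed.

Section Parametrization.
Variables (R : realType) (K : fieldType) (v : K -> \bar R).
Hypothesis vP : ring_valuation v.
Variables (m : nat) (s : {perm 'I_m}).
Implicit Types (e f : ordpair m) (M N : multinom #|{: ordpair m}|).
Implicit Types (p : coord_poly K m).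

Let vNy c : v c != -oo%E. Proof. by case: vP. Qed.
Let v0 : v 0 = +oo%E. Proof. by case: vP. Qed.
Let v1 : v 1 = 0%E. Proof. by case: vP. Qed.

(* The generic point [x_ij = t_i t_j (u_j - u_i)] of the cone, where [u_i] is the
   sum of the gaps that precede the position of [i]. *)
Definition scale_var (i : 'I_m) : mpoly (m + m) K := mpolyX K (mnm1 (lshift m i)).
Definition gap_var (q : 'I_m) : mpoly (m + m) K := mpolyX K (mnm1 (rshift m q)).

Definition point_var (i : 'I_m) : mpoly (m + m) K :=
  \sum_(q < m | (q < s i)%N) gap_var q.

Definition param_coord e : mpoly (m + m) K :=
  scale_var (val e).1 * scale_var (val e).2 *
  (point_var (val e).2 - point_var (val e).1).

Definition param p : mpoly (m + m) K :=
  comp_mpoly [tuple param_coord (enum_val k) | k < #|{: ordpair m}|] p.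

Lemma param_vanishing p : (exists2 a : K, a != 0 & forall k : int, a ^ k = 1 -> k = 0) ->
  vanishing_ideal p -> param p = 0.
Proof.
move=> [a a0 aoo] /asboolP pX; apply: (mpoly_vanishing a0 aoo) => z.
rewrite /param comp_mpoly_meval.
pose t i := meval z (scale_var i); pose u i := meval z (point_var i).
rewrite -[RHS](pX (fun e => meval z (param_coord e))).
  by rewrite /coord_eval; apply: meval_eq => k; rewrite tnth_mktuple.
(* The specialized point has the Plücker coordinates of the plane spanned by the vectors [t_i] and
   [t_i u_i]. *)
exists t, (fun i => t i * u i) => e.
rewrite /param_coord !mevalM mevalB -/(t _) -/(t _) -/(u _) -/(u _); ring.
Qed.

Lemma param_pi_eq p q : (exists2 a : K, a != 0 & forall k : int, a ^ k = 1 -> k = 0) ->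
  \pi_(coord_ring K m)%qT p = \pi_(coord_ring K m)%qT q -> param p = param q.
Proof.
move=> ha /eqP; rewrite -Quotient.idealrBE => /(param_vanishing ha) /eqP.
by rewrite /param rmorphB subr_eq0 => /eqP.
Qed.

Lemma paramX M :
  param (mpolyX K M) = \prod_k param_coord (enum_val k) ^+ M k.
Proof.
by rewrite /param comp_mpolyX; apply: eq_bigr => k _; rewrite tnth_mktuple.
Qed.

Lemma paramC (c : K) : param (mpolyC _ c) = mpolyC _ c.
Proof. by rewrite /param comp_mpolyC. Qed.

Lemma paramE p : param p = \sum_(M <- msupp p) mcoeff M p *: param (mpolyX K M).
Proof.
rewrite {1}(mpolyE p) /param raddf_sum; apply: eq_bigr => M _ /=.
by rewrite comp_mpolyZ.
Qed.

Variables (tau delta : 'I_m -> \bar R).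
Hypothesis tauNy : forall i, tau i != -oo%E.
Hypothesis deltaNy : forall q, delta q != -oo%E.

Definition param_weight (k : 'I_(m + m)) : \bar R :=
  match fintype.split k with inl i => tau i | inr q => delta q end.

Lemma param_weight_l i : param_weight (lshift m i) = tau i.
Proof. by rewrite /param_weight (unsplitK (inl _ i)). Qed.

Lemma param_weight_r q : param_weight (rshift m q) = delta q.
Proof. by rewrite /param_weight (unsplitK (inr _ q)). Qed.

Lemma param_weightNy k : param_weight k != -oo%E.
Proof. by rewrite /param_weight; case: fintype.split. Qed.

Let gaussw := gauss v param_weight.
Let gvP : ring_valuation gaussw := gauss_valuation vP param_weightNy.

(* Ties in [delta] are broken so that a minimal gap of an arc is its lead. *)
Definition gap_key (q : 'I_m) : \bar R *l (multinom (m + m))^d :=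
  (delta q, mnm1 (rshift m q)).

Lemma gap_key_inj : injective gap_key.
Proof.
by move=> q q' /(congr1 snd) /eqP; rewrite eq_mnm1 => /eqP /rshift_inj.
Qed.

Definition in_arc e (q : 'I_m) : bool := (arc_lo s e <= q < arc_hi s e)%N.

Definition arc_first e : 'I_m := Ordinal (ltn_trans (arc_lo_hi s e) (arc_hi_bound s e)).

Lemma in_arc_first e : in_arc e (arc_first e).
Proof. by rewrite /in_arc leqnn arc_lo_hi. Qed.

Definition arc_top e : 'I_m := [arg min_(q < arc_first e | in_arc e q) gap_key q]%O.

Lemma arc_top_in e : in_arc e (arc_top e).
Proof. by rewrite /arc_top; case: (arg_minP gap_key (in_arc_first e)). Qed.

Lemma arc_top_min e q : in_arc e q -> (gap_key (arc_top e) <= gap_key q)%O.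
Proof.
by rewrite /arc_top; case: (arg_minP gap_key (in_arc_first e)) => r _; apply.
Qed.

Definition arc_gap e : mpoly (m + m) K := \sum_(q | in_arc e q) gap_var q.

Lemma point_var_diff e : exists b : nat,
  point_var (val e).2 - point_var (val e).1 = (-1) ^+ b *: arc_gap e.
Proof.
have diff i j : (s i <= s j)%N -> point_var j - point_var i =
    \sum_(q < m | (s i <= q < s j)%N) gap_var q.
  move=> ij; rewrite /point_var [X in X - _](bigID (fun q : 'I_m => (q < s i)%N)) /=.
  rewrite addrAC [X in X - _](eq_bigl (fun q : 'I_m => (q < s i)%N)); last first.
    by move=> q; apply/idP/idP; lia.
  by rewrite subrr add0r; apply: eq_bigl => q; apply/idP/idP; lia.
have [le|/ltnW le] := leqP (s (val e).1) (s (val e).2).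
  exists 0%N; rewrite expr0 scale1r diff //; apply: eq_bigl => q.
  by rewrite /in_arc /arc_lo /arc_hi (minn_idPl le) (maxn_idPr le).
exists 1%N; rewrite expr1 scaleN1r -opprB diff //; congr (- _); apply: eq_bigl => q.
by rewrite /in_arc /arc_lo /arc_hi (minn_idPr le) (maxn_idPl le).
Qed.

Lemma arc_gap_term e q : in_arc e q ->
  gauss_term v param_weight (arc_gap e) (mnm1 (rshift m q)) = delta q.
Proof.
move=> eq; rewrite /gauss_term mono_weight1 param_weight_r /arc_gap raddf_sum /=.
rewrite (bigD1 q) //= mcoeffX eqxx big1 ?addr0 ?v1 ?add0e // => r /andP[_ rq].
by rewrite mcoeffX eq_mnm1 (inj_eq (@rshift_inj _ _)) (negbTE rq).
Qed.

Lemma arc_gap_termP e k :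
  (exists2 q, in_arc e q & k = mnm1 (rshift m q)) \/
  gauss_term v param_weight (arc_gap e) k = +oo%E.
Proof.
have [[q]|no] := pselect (exists2 q, in_arc e q & k = mnm1 (rshift m q)).
  by left; exists q.
right; rewrite /gauss_term /arc_gap raddf_sum /= big1 ?v0 ?addye //.
  by rewrite mono_weightNy // => ?; exact: param_weightNy.
by move=> q eq; rewrite mcoeffX; case: eqP => // E; case: no; exists q.
Qed.

Lemma gauss_arc_gap e : gaussw (arc_gap e) = delta (arc_top e).
Proof.
apply/eqP; rewrite eq_le -{1}(arc_gap_term (arc_top_in e)).
rewrite gauss_le //=; last exact: param_weightNy.
apply: le_gauss => k; have [[q eq ->]|->] := arc_gap_termP e k; last exact: leey.
rewrite arc_gap_term //; have := arc_top_min eq.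
by rewrite lexi_pair => /andP[].
Qed.

Lemma is_lead_arc_gap e : (delta (arc_top e) < +oo)%E ->
  is_lead v param_weight (arc_gap e) (mnm1 (rshift m (arc_top e))).
Proof.
move=> oo; split; rewrite -/gaussw gauss_arc_gap.
  by rewrite arc_gap_term // arc_top_in.
move=> k; have [[q eq ->]|->] := arc_gap_termP e k; last by [].
rewrite arc_gap_term // => lt; have := arc_top_min eq.
rewrite lexi_pair => /andP[le1 /implyP le2].
rewrite lt_neqAle le1 andbT; apply: contraTneq lt => E.
by rewrite -leNgt; have := le2 _; rewrite /= E lexx => /(_ isT).
Qed.

Lemma gaussZ_sign b (g : mpoly (m + m) K) : gaussw ((-1) ^+ b *: g) = gaussw g.
Proof.
rewrite /gaussw gaussZ //; last exact: param_weightNy.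
by rewrite (valuationX vP) (valuation_N1 vP) mul0rn add0e.
Qed.

Lemma is_leadZ_sign b (g : mpoly (m + m) K) l :
  is_lead v param_weight g l -> is_lead v param_weight ((-1) ^+ b *: g) l.
Proof.
have tE k : gauss_term v param_weight ((-1) ^+ b *: g) k = gauss_term v param_weight g k.
  by rewrite gauss_termZ // (valuationX vP) (valuation_N1 vP) mul0rn add0e.
rewrite /is_lead -!/gaussw gaussZ_sign tE => -[-> H]; split=> // k /H.
by rewrite tE.
Qed.

Lemma gauss_scale_var i : gaussw (scale_var i) = tau i.
Proof. by rewrite /gaussw gaussX // mono_weight1 param_weight_l. Qed.

Lemma gauss_param_coord e :
  gaussw (param_coord e) = (tau (val e).1 + tau (val e).2 + delta (arc_top e))%E.
Proof.
have [_ _ _ gM _] := gvP; have [b bE] := point_var_diff e.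
by rewrite /param_coord bE !gM gaussZ_sign gauss_arc_gap !gauss_scale_var.
Qed.

Definition coord_lead e : multinom (m + m) :=
  mnm_add (mnm_add (mnm1 (lshift m (val e).1)) (mnm1 (lshift m (val e).2)))
          (mnm1 (rshift m (arc_top e))).

Lemma is_lead_param_coord e : (gaussw (param_coord e) < +oo)%E ->
  is_lead v param_weight (param_coord e) (coord_lead e).
Proof.
rewrite gauss_param_coord => fin.
have fin2 (x y : \bar R) : x != -oo%E -> y != -oo%E -> (x + y < +oo)%E ->
    (x < +oo)%E /\ (y < +oo)%E.
  by case: x => [x| |] //; case: y => [y| |] //; rewrite ?ltry.
have tN : (tau (val e).1 + tau (val e).2)%E != -oo%E.
  by rewrite adde_eq_ninfty negb_or !tauNy.
have [tt dd] := fin2 _ _ tN (deltaNy _) fin.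
have [t1 t2] := fin2 _ _ (tauNy _) (tauNy _) tt.
have leadt i : (tau i < +oo)%E -> is_lead v param_weight (scale_var i) (mnm1 (lshift m i)).
  by move=> ?; apply: is_leadX => //; [exact: param_weightNy|rewrite mono_weight1 param_weight_l].
have [b bE] := point_var_diff e.
rewrite /param_coord bE.
have [_ _ _ gM _] := gvP.
apply: (proj2 (gaussM_lead vP param_weightNy _ _ _ _)).
- by rewrite -/gaussw gM !gauss_scale_var.
- by rewrite -/gaussw gaussZ_sign gauss_arc_gap.
- apply: (proj2 (gaussM_lead vP param_weightNy _ _ _ _)); rewrite -/gaussw ?gauss_scale_var //; exact: leadt.
- by apply: is_leadZ_sign; exact: is_lead_arc_gap.
Qed.

Definition param_trop (k : 'I_#|{: ordpair m}|) : \bar R :=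
  gaussw (param_coord (enum_val k)).

Lemma param_tropNy k : param_trop k != -oo%E.
Proof. by case: gvP => /(_ (param_coord (enum_val k))). Qed.

Lemma gauss_paramX M : gaussw (param (mpolyX K M)) = mono_weight param_trop M.
Proof.
rewrite paramX (valuation_prod gvP); apply: eq_bigr => k _.
by rewrite (valuationX gvP).
Qed.

(** The ultrametric inequality over the terms of [p]. It holds for every lift, noncrossing or not,
    and so bounds the contributions of all other orders to the section. *)
Lemma param_trop_le p : (gauss v param_trop p <= gaussw (param p))%E.
Proof.
rewrite paramE; apply: gauss_sum_ge => // [|M Mp]; first exact: param_weightNy.
rewrite gaussZ //; last exact: param_weightNy.
by rewrite -/gaussw gauss_paramX; apply: gauss_le => //; exact: param_tropNy.
Qed.

(** Only coordinates that occur in [M] enter, because a coordinate of infinite value has no lead. *)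
Definition mono_lead M : multinom (m + m) :=
  \big[mnm_add/mnm0]_(k | M k != 0%N)
    \big[mnm_add/mnm0]_(j < M k) coord_lead (enum_val k).

Lemma mono_weight_fin n (w : 'I_n -> \bar R) (k : multinom n) i :
  (forall i, w i != -oo%E) -> (mono_weight w k < +oo)%E -> k i != 0%N ->
  (w i < +oo)%E.
Proof.
move=> wNy fin ki; rewrite ltNge leye_eq; apply/negP => /eqP wi.
suff H : mono_weight w k = +oo%E by rewrite H ltxx in fin.
apply/esum_eqyP => [j _|].
  elim: (k j) => [|c IH]; first by rewrite mulr0n.
  by rewrite mulrS adde_eq_ninfty negb_or wNy.
exists i; split; rewrite ?mem_index_enum // wi.
case: (k i) ki => // c _; elim: c => [|c IH]; first by rewrite mulr1n.
by rewrite mulrS IH.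
Qed.

Lemma is_lead_paramX M : (gaussw (param (mpolyX K M)) < +oo)%E ->
  is_lead v param_weight (param (mpolyX K M)) (mono_lead M).
Proof.
rewrite gauss_paramX => fin; rewrite paramX.
rewrite (_ : \prod_k _ = \prod_(k | M k != 0%N) param_coord (enum_val k) ^+ M k); last first.
  by rewrite [RHS]big_mkcond; apply: eq_bigr => k _; case: eqP => //= ->; rewrite expr0.
have H k : M k != 0%N -> (gaussw (param_coord (enum_val k) ^+ M k)%R < +oo)%E /\
    is_lead v param_weight (param_coord (enum_val k) ^+ M k)
      (\big[mnm_add/mnm0]_(j < M k) coord_lead (enum_val k)).
  move=> Mk; have koo := mono_weight_fin param_tropNy fin Mk.
  rewrite -[X in _ ^+ X]card_ord -prodr_const.
  apply: is_lead_prod => // [|j _]; first exact: param_weightNy.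
  by split=> //; apply: is_lead_param_coord.
by case: (is_lead_prod vP param_weightNy (index_enum _) H).
Qed.

Lemma mono_lead_l M i : mono_lead M (lshift m i) = arc_degree M i.
Proof.
rewrite /mono_lead mnm_sumE /arc_degree (reindex (@enum_rank (ordpair m))) /=; last first.
  by exists enum_val => e _; rewrite ?enum_rankK ?enum_valK.
rewrite big_mkcond; apply: eq_bigr => e _ /=.
rewrite mnm_sumE sum_nat_const card_ord enum_rankK /coord_lead !mnmDE !mnm1E.
rewrite !(inj_eq (@lshift_inj _ _)) eq_rlshift addn0 -/(arc_mult M e).
by case: (arc_mult M e).
Qed.

Lemma mono_lead_r M q : mono_lead M (rshift m q) = top_count arc_top M q.
Proof.
rewrite /mono_lead mnm_sumE /top_count (reindex (@enum_rank (ordpair m))) /=; last first.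
  by exists enum_val => e _; rewrite ?enum_rankK ?enum_valK.
rewrite big_mkcond; apply: eq_bigr => e _ /=.
rewrite mnm_sumE sum_nat_const card_ord enum_rankK /coord_lead !mnmDE !mnm1E.
rewrite !eq_lrshift (inj_eq (@rshift_inj _ _)) !add0n -/(arc_mult M e).
by case: (arc_mult M e).
Qed.

(** The exponents of a lead are the degrees and top counts, so [noncrossing_unique] makes the leads
    of the terms distinct and [gauss_ortho] rules out cancellation. *)
Lemma gauss_param_noncrossing p : noncrossing_poly s p ->
  gaussw (param p) = gauss v param_trop p.
Proof.
move=> np; rewrite paramE /gaussw.
rewrite (@gauss_ortho _ _ _ vP _ _ param_weightNy _ (msupp p) (fun M => mcoeff M p)
  (fun M => param (mpolyX K M)) mono_lead).
- by apply: eq_bigr => M _; rewrite -/gaussw gauss_paramX.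
- exact: msupp_uniq.
- by move=> M _; exact: is_lead_paramX.
move=> M N Mp Np _ _ E; apply: (noncrossing_unique gap_key_inj arc_top_in arc_top_min).
- exact: np.
- exact: np.
- by move=> i; rewrite -!mono_lead_l E.
- by move=> q; rewrite -!mono_lead_r E.
Qed.

End Parametrization.

(** * Tropical points *)

Section PlanarOrder.
Variables (d : Order.disp_t) (O : orderType d) (T : eqType) (eta : T -> T -> O).
Hypothesis eta_sym : forall x y, eta x y = eta y x.
Hypothesis eta_ultra : forall x y z,
  (Order.min (eta x y) (eta y z) <= eta x z)%O.

(** A large value of [eta] means near: each element is followed by a nearest one among those that
    remain. *)
Fixpoint greedy x (l : seq T) : bool :=
  if l is y :: l' then all (fun z => eta x z <= eta x y)%O l' && greedy y l'
  else true.

Lemma greedy_ex x l : exists l', perm_eq l l' /\ greedy x l'.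
Proof.
have [k] := ubnP (size l); elim: k x l => // k IH x l lk.
have [->|l0] := eqVneq l [::]; first by exists [::].
have [|_ /mapP[y yl ->] ymax] := @seq_has_max _ _ (map (eta x) l).
  by apply: contra_neq l0 => /eqP; rewrite -size_eq0 size_map size_eq0 => /eqP.
have [|l' [pl' gl']] := IH y (rem y l).
  by rewrite size_rem //; case: l yl lk {l0 ymax}.
exists (y :: l'); split.
  by apply: perm_trans (perm_to_rem yl) _; rewrite perm_cons.
rewrite /= gl' andbT; apply/allP => z zl'; apply: ymax; apply: map_f.
by rewrite -(perm_mem pl') in zl'; exact: mem_rem zl'.
Qed.

Lemma greedy_nth x0 x l i j : greedy x l -> (i < j < size (x :: l))%N ->
  (eta (nth x0 (x :: l) i) (nth x0 (x :: l) j) <=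
   eta (nth x0 (x :: l) i) (nth x0 (x :: l) i.+1))%O.
Proof.
elim: l x i j => [|y l IH] x i j; first by move=> _; case: j => // j /andP[].
move=> /= /andP[/allP xl gl] /andP[ij jl].
case: i ij => [|i] ij.
  case: j ij jl => // -[|j] //= _ jl; apply: xl; apply: mem_nth; move: jl => /=; lia.
by case: j ij jl => // j ij jl; apply: IH => //=; rewrite -ltnS ij.
Qed.

(* In a greedy order, passing from an element to its successor can only bring
   us closer to any later element. *)
Lemma greedy_gap x0 x l i j q : greedy x l -> (i <= q < j)%N ->
  (j < size (x :: l))%N ->
  (eta (nth x0 (x :: l) i) (nth x0 (x :: l) j) <=
   eta (nth x0 (x :: l) q) (nth x0 (x :: l) q.+1))%O.
Proof.
move=> gl /andP[iq qj] jl.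
apply: (@le_trans _ _ (eta (nth x0 (x :: l) q) (nth x0 (x :: l) j))); last first.
  by apply: greedy_nth; rewrite ?qj.
rewrite -(subnKC iq); move: (q - i)%N (subnKC iq) => c qE.
move: qj; rewrite -{q iq}qE; elim: c => [|c IH] qj; first by rewrite addn0.
apply: (le_trans (IH _)); first by lia.
set a := nth _ _ (i + c); set b := nth _ _ j; rewrite addnS; set a' := nth _ _ _.+1.
have := eta_ultra a' a b; rewrite eta_sym min_r //.
by apply: greedy_nth => //; lia.
Qed.

Lemma ultra_chain (f : nat -> T) i j : (i < j)%N ->
  exists2 q, (i <= q < j)%N & (eta (f q) (f q.+1) <= eta (f i) (f j))%O.
Proof.
elim: j => // j IH; rewrite ltnS leq_eqVlt => /orP[/eqP ->|/[dup] ij /IH[q iqj le]].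
  by exists j; rewrite ?leqnn.
have := eta_ultra (f i) (f j) (f j.+1); rewrite ge_min => /orP[le'|le'].
  by exists q; [lia|exact: le_trans le le'].
by exists j; [lia|].
Qed.

End PlanarOrder.

(** The order is greedy and [delta] lists the values of [eta] on neighbours. Greediness bounds every
    gap from below, and the iterated ultrametric inequality supplies a gap that is small enough. *)
Lemma planar_order d (O : orderType d) (m : nat) (eta : 'I_m -> 'I_m -> O) :
  (forall i j, eta i j = eta j i) ->
  (forall i j k, (Order.min (eta i j) (eta j k) <= eta i k)%O) ->
  exists (s : {perm 'I_m}) (delta : 'I_m -> O), forall i j, (s i < s j)%N ->
    (forall q : 'I_m, (s i <= q < s j)%N -> (eta i j <= delta q)%O) /\
    exists2 q : 'I_m, (s i <= q < s j)%N & (delta q <= eta i j)%O.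
Proof.
case: m eta => [|m] eta eta_sym eta_ultra.
  by exists 1%g, (fun i => eta i i) => -[].
have [l [pl gl]] := greedy_ex eta ord0 (rem ord0 (enum 'I_m.+1)).
pose t := ord0 :: l.
have tP : perm_eq (enum 'I_m.+1) t.
  apply: (perm_trans (@perm_to_rem _ ord0 _ _)); first by rewrite mem_enum.
  by rewrite /t perm_cons.
have ts : size t = m.+1 by rewrite -(perm_size tP) size_enum_ord.
have tin i : i \in t by rewrite -(perm_mem tP) mem_enum.
have tlt i : (index i t < m.+1)%N by rewrite -[X in (_ < X)%N]ts index_mem.
have sinj : injective (fun i => Ordinal (tlt i)).
  by move=> i j [/(congr1 (nth ord0 t))]; rewrite !nth_index.
(* At the last position the successor is the default [ord0]; this value is harmless, since a gap
   between two leaves is never the last position. *)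
exists (perm sinj), (fun q : 'I_m.+1 => eta (nth ord0 t q) (nth ord0 t q.+1)).
move=> i j; rewrite !permE /= => ij.
have nt : eta i j = eta (nth ord0 t (index i t)) (nth ord0 t (index j t)).
  by rewrite !nth_index.
split=> [q qij|].
  by rewrite nt; apply: greedy_gap => //; rewrite -/t [X in (_ < X)%N]ts; exact: tlt.
have [q qij le] := ultra_chain eta_ultra (nth ord0 t) ij.
have qm : (q < m.+1)%N by case/andP: qij => _ qj; exact: ltn_trans qj (tlt j).
by exists (Ordinal qm); rewrite //= nt.
Qed.

(** * From tropical Plücker vectors to ultrametrics *)

Section TropicalPlucker.
Variables (R : realType) (m : nat) (X : 'I_m -> 'I_m -> \bar R).
Hypothesis X_Ny : forall i j, X i j != -oo%E.
Hypothesis X_sym : forall i j, X i j = X j i.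
Hypothesis X_plucker : forall i j k l,
  (Order.min (X i j + X k l) (X i l + X j k) <= X i k + X j l)%E.

Let norm (j : 'I_m) : \bar R := (\big[mine/+oo]_(a <- enum 'I_m) X a j)%E.

Let norm_le a j : (norm j <= X a j)%E.
Proof. by apply: (@ge_bigmin_seq _ _ _ _ _ a xpredT (X ^~ j)); rewrite ?mem_enum. Qed.

Let norm_Ny j : norm j != -oo%E.
Proof.
have [E|//] := eqVneq (norm j) -oo%E.
have [|a _] := @bigmine_attained R _ (enum 'I_m) (X ^~ j).
  by rewrite -/(norm j) E.
by rewrite -/(norm j) E => /eqP; rewrite (negbTE (X_Ny a j)).
Qed.

Let norm_ultra i j k :
  (Order.min (X i j + norm k) (X j k + norm i) <= X i k + norm j)%E.
Proof.
have [joo|] := ltP (norm j) +oo%E; last first.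
  by rewrite leye_eq => /eqP ->; rewrite addey ?leey.
(* The Plücker inequality is used with a fourth leaf [a] that attains [norm j]; its other entries
   [X k a] and [X i a] are at least [norm k] and [norm i]. *)
have [a _] := bigmine_attained joo; rewrite -/(norm j) => <-.
rewrite (X_sym a j); apply: le_trans (X_plucker i j k a).
rewrite le_min !ge_min; apply/andP; split; apply/orP.
  by left; apply: leeD => //; rewrite X_sym norm_le.
by right; rewrite addeC; apply: leeD => //; rewrite X_sym norm_le.
Qed.

(* An ultrametric. As [+oo - +oo = -oo], a loop (an [i] with [X i j = +oo] for
   all [j]) is infinitely far away from everything, so that no loop is placed
   between two leaves that are not loops. *)
Let dist i j : \bar R := (X i j - (norm i + norm j))%E.

Let dist_loop i j : norm i = +oo%E -> dist i j = -oo%E.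
Proof. by move=> E; rewrite /dist E addye ?norm_Ny //= addeNy. Qed.

Let dist_sym i j : dist i j = dist j i.
Proof. by rewrite /dist X_sym addeC [X in (_ - X)%E]addeC addeC. Qed.

Let norm_fin i : norm i != +oo%E -> norm i = (fine (norm i))%:E.
Proof. by move=> ioo; rewrite fineK // fin_numE norm_Ny. Qed.

Let dist_ultra i j k : (Order.min (dist i j) (dist j k) <= dist i k)%E.
Proof.
have [E|/norm_fin iE] := eqVneq (norm i) +oo%E.
  by rewrite dist_loop // ge_min leNye.
have [E|/norm_fin jE] := eqVneq (norm j) +oo%E.
  by rewrite (dist_loop k) // ge_min leNye orbT.
have [E|/norm_fin kE] := eqVneq (norm k) +oo%E.
  by rewrite [dist j k]dist_sym [dist k j]dist_loop // ge_min leNye orbT.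
have := norm_ultra i j k; rewrite !ge_min /dist iE jE kE.
move: (X_Ny i k) (X_Ny i j) (X_Ny j k).
case: (X i k) => [x| |] // _; last by move=> *; rewrite leey.
case: (X i j) => [y| |] // _; case: (X j k) => [z| |] // _;
  by rewrite -?EFinD -?EFinN -?EFinD ?lee_fin ?addye //= ?leye_eq /= ?orbF => H; lra.
Qed.

Lemma tropical_plucker_param : exists (s : {perm 'I_m}) (tau delta : 'I_m -> \bar R),
  [/\ forall i, tau i != -oo%E, forall q, delta q != -oo%E &
    forall i j, (s i < s j)%N ->
    (forall q : 'I_m, (s i <= q < s j)%N -> (X i j <= tau i + tau j + delta q)%E) /\
    exists2 q : 'I_m, (s i <= q < s j)%N & (tau i + tau j + delta q <= X i j)%E].
Proof.
have [s [delta sP]] := planar_order dist_sym dist_ultra.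
(* Weights must not be [-oo]. A gap with [delta q = -oo] never lies between two leaves that are not
   loops, and if an end is a loop both sides are [+oo], so any other value will do. *)
exists s, norm, (fun q => if delta q == -oo%E then 0%E else delta q).
have dNy q : (if delta q == -oo%E then 0%E else delta q) != -oo%E.
  by case: ifPn.
split=> // i j ij; have [le [q qij ge]] := sP i j ij.
have Xoo : norm i = +oo%E \/ norm j = +oo%E -> X i j = +oo%E.
  move=> h; apply/eqP; rewrite -leye_eq.
  by case: h => <-; rewrite ?norm_le // X_sym norm_le.
have [h|] := pselect (norm i = +oo%E \/ norm j = +oo%E).
  have noo : (norm i + norm j)%E = +oo%E.
    by case: h => ->; rewrite ?addye ?addey ?norm_Ny.
  split=> [q' _|]; first by rewrite noo addye ?leey.
  by exists q; rewrite // Xoo // leey.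
move=> /not_orP[/eqP /norm_fin iE /eqP /norm_fin jE].
have dE : X i j = (norm i + norm j + dist i j)%E.
  by rewrite /dist iE jE addeC -EFinD subeK.
have dijNy : dist i j != -oo%E.
  by rewrite /dist iE jE -EFinD adde_eq_ninfty negb_or X_Ny.
have deltaE (q' : 'I_m) : (s i <= q' < s j)%N -> delta q' != -oo%E.
  by move=> /le h; apply: contra_neq dijNy => E; apply/eqP; rewrite -leeNy_eq -E.
split=> [q' q'ij|]; last exists q => //; rewrite (negbTE (deltaE _ _)) // dE; apply: leeD => //.
exact: le.
Qed.

End TropicalPlucker.

(** * The section *)

Section WeightDecomposition.
Variables (K : fieldType) (m : nat).
Implicit Types (M : multinom #|{: ordpair m}|) (F : coord_poly K m).

Definition mono_wt M : weight m := [ffun i => (arc_degree M i)%:Z].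

Definition poly_component F (b : weight m) : coord_poly K m :=
  \sum_(M <- msupp F | mono_wt M == b) mcoeff M F *: mpolyX K M.

Lemma mcoeff_component F b M :
  mcoeff M (poly_component F b) = if mono_wt M == b then mcoeff M F else 0.
Proof.
rewrite /poly_component raddf_sum /=.
under eq_bigr do rewrite mcoeffZ mcoeffX.
have [MF|MF] := boolP (M \in msupp F).
  rewrite big_mkcond (bigD1_seq M) //= eqxx mulr1 big1 ?addr0 // => N NM.
  by rewrite (negbTE NM) mulr0 if_same.
rewrite (memN_msupp_eq0 MF) if_same big_seq_cond big1 // => N /andP[NF _].
by case: eqP => [E|]; [rewrite -E NF in MF|rewrite mulr0].
Qed.

Lemma poly_component0 F b : b \notin map mono_wt (msupp F) -> poly_component F b = 0.
Proof.
move=> bF; apply/mpolyP => M; rewrite mcoeff_component mcoeff0.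
case: eqP => // Mb; apply/eqP; rewrite mcoeff_eq0; apply: contra bF => MF.
by rewrite -Mb map_f.
Qed.

Lemma prod_arc_degree (t : 'I_m -> K) M :
  \prod_i t i ^+ arc_degree M i =
  \prod_e (t (val e).1 * t (val e).2) ^+ arc_mult M e.
Proof.
under eq_bigr do rewrite /arc_degree -prodrXr.
rewrite exchange_big /=; apply: eq_bigr => e _.
under eq_bigr do rewrite mulnC exprM exprD.
rewrite prodrXl big_split /= (bigD1 (val e).1) //= eqxx expr1 big1 ?mulr1; last first.
  by move=> i; rewrite eq_sym => /negbTE ->.
rewrite (bigD1 (val e).2) //= eqxx expr1 big1 ?mulr1 // => i.
by rewrite eq_sym => /negbTE ->.
Qed.

Lemma coord_evalX (x : ordpair m -> K) M :
  coord_eval x (mpolyX K M) = \prod_e x e ^+ arc_mult M e.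
Proof.
rewrite /coord_eval mevalX (reindex (@enum_rank (ordpair m))) /=; last first.
  by exists enum_val => e _; rewrite ?enum_rankK ?enum_valK.
by apply: eq_bigr => e _; rewrite enum_rankK.
Qed.

Lemma poly_component_decomposition F :
  weight_decomposition (\pi_(coord_ring K m)%qT F)
    (fun b => \pi_(coord_ring K m)%qT (poly_component F b)).
Proof.
have pi0 : \pi_(coord_ring K m)%qT (0 : coord_poly K m) = 0 by exact: pi_zeror.
have piD : {morph \pi_(coord_ring K m)%qT : x y / x + y} by exact: pi_addr.
pose W := finmap.seq_fset tt (map mono_wt (msupp F)).
have out b : b \notin W -> poly_component F b = 0.
  by rewrite finmap.seq_fsetE; exact: poly_component0.
split.
- apply: sub_finite_set (finite_fset W) => b /= nz.
  by apply: contraNT nz => /out ->; rewrite pi0 eqxx.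
- move=> b t t0 x xX; rewrite !ring_eval_pi //; last exact: torus_act_cone.
  rewrite !coord_evalE /poly_component !raddf_sum /= mulr_sumr.
  apply: eq_bigr => M /eqP <-.
  rewrite !mevalZ mulrCA -!coord_evalE !coord_evalX; congr (_ * _).
  rewrite (_ : \prod_i t i ^ _ = \prod_i t i ^+ arc_degree M i); last first.
    by apply: eq_bigr => i _; rewrite ffunE.
  rewrite prod_arc_degree -big_split; apply: eq_bigr => e _ /=.
  by rewrite -exprMn.
- rewrite (@fsbigTE _ _ _ _ W) /=; last by move=> b /out ->; rewrite pi0.
  rewrite -(big_morph _ piD pi0); congr (\pi_(coord_ring K m) _)%qT.
  apply/mpolyP => M; rewrite raddf_sum /=.
  under eq_bigr do rewrite mcoeff_component.
  have [MF|/memN_msupp_eq0 ->] := boolP (M \in msupp F); last first.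
    by rewrite big1 // => b _; rewrite if_same.
  have MW : mono_wt M \in finmap.enum_fset W.
    by rewrite [_ \in _]finmap.seq_fsetE map_f.
  have uW : uniq (finmap.enum_fset W) by exact: finmap.fset_uniq.
  rewrite (bigD1_seq (mono_wt M) MW uW). rewrite /= eqxx big1 ?addr0 // => b.
  by rewrite eq_sym => /negbTE ->.
Qed.

Lemma noncrossing_component (s : {perm 'I_m}) F b :
  noncrossing_poly s F -> noncrossing_poly s (poly_component F b).
Proof.
move=> nF M; rewrite mcoeff_msupp mcoeff_component; case: ifP => [_|]; last by rewrite eqxx.
by rewrite -mcoeff_msupp; exact: nF.
Qed.

Lemma mono_wt_dot (R : realType) (tau : 'I_m -> R) M :
  \sum_i (mono_wt M i)%:~R * tau i =
  \sum_e (tau (val e).1 + tau (val e).2) *+ arc_mult M e.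
Proof.
under eq_bigr do rewrite ffunE -pmulrn /arc_degree natr_sum mulr_suml.
rewrite exchange_big /=; apply: eq_bigr => e _.
rewrite -mulr_natl mulrDr (bigD1 (val e).1) //=.
have [E|ne] := eqVneq (val e).1 (val e).2.
  by have := valP e; rewrite /= E ltnn.
rewrite (bigD1 (val e).2) /=; last by rewrite eq_sym.
rewrite !eqxx (negbTE ne) addn0 add0n muln1 big1 ?addr0 // => i.
by rewrite ![i == _]eq_sym => /andP[/negbTE -> /negbTE ->]; rewrite muln0 mul0r.
Qed.

End WeightDecomposition.

(** * Continuity of Gauss valuations in the weights *)

Section Continuity.
Variable R : realType.

(** Addition of extended reals is continuous away from pairs of opposite infinities, which
    [a i != -oo] excludes at the limit. *)
Lemma cvg_mono_weight (T : Type) (G : set_system T) (FG : Filter G) n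
    (F : 'I_n -> T -> \bar R) (a : 'I_n -> \bar R) (k : multinom n) :
  (forall i, a i != -oo%E) -> (forall i, F i x @[x --> G] --> a i) ->
  mono_weight (F ^~ x) k @[x --> G] --> mono_weight a k.
Proof.
move=> aNy Fa.
have def (x y : \bar R) : x != -oo%E -> y != -oo%E -> (x +? y)%E.
  by case: x => [x| |] //; case: y.
have powNy i j : (a i *+ j)%R != -oo%E.
  by elim: j => [|j IH]; rewrite ?mulr0n // mulrS adde_eq_ninfty negb_or aNy.
have pow i j : (F i x *+ j)%R @[x --> G] --> (a i *+ j)%R.
  elim: j => [|j IH].
    by rewrite mulr0n; under eq_fun do rewrite mulr0n; exact: cvg_cst.
  rewrite mulrS; under eq_fun do rewrite mulrS.
  by apply: cvgeD => //; exact: def.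
rewrite /mono_weight; elim: (index_enum _) => [|i s IH].
  by rewrite big_nil; under eq_fun do rewrite big_nil; exact: cvg_cst.
rewrite big_cons; under eq_fun do rewrite big_cons.
apply: cvgeD => //; apply: def => //.
by apply/eqP => /esum_eqNyP [j [_ _ /eqP]]; rewrite (negbTE (powNy _ _)).
Qed.

Lemma cvg_gauss (K : fieldType) (v : K -> \bar R) (T : Type) (G : set_system T)
    (FG : Filter G) n (F : 'I_n -> T -> \bar R) (a : 'I_n -> \bar R)
    (p : mpoly n K) : ring_valuation v ->
  (forall i, a i != -oo%E) -> (forall i, F i x @[x --> G] --> a i) ->
  gauss v (F ^~ x) p @[x --> G] --> gauss v a p.
Proof.
move=> [vNy _ _ _ _] aNy Fa.
apply: (cvg_big min_continuous (Ff := fun k x => gauss_term v (F ^~ x) p k)) => k _.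
apply: (@cvgeD _ _ _ R (fun=> v (mcoeff k p))
  (fun x => mono_weight (F ^~ x) k)).
- have := mono_weightNy aNy k; move: (vNy (mcoeff k p)).
  by case: (v _) => [c| |] //= _; case: (mono_weight _ _).
- exact: cvg_cst.
- exact: cvg_mono_weight.
Qed.

End Continuity.

(** * Points of the analytification obtained from the parametrization *)

Section PointValuation.
Variables (R : realType) (K : fieldType) (v : K -> \bar R) (m : nat).
Hypothesis vP : ring_valuation v.
Hypothesis aoo : exists2 a : K, a != 0 & forall k : int, a ^ k = 1 -> k = 0.
Variables (s : {perm 'I_m}) (tau delta : 'I_m -> \bar R).
Hypothesis tauNy : forall i, tau i != -oo%E.
Hypothesis deltaNy : forall q, delta q != -oo%E.

Definition point_val : val_space R K m :=
  fun f => gauss v (param_weight tau delta) (param s (repr f)).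

Lemma point_val_pi p : point_val (\pi_(coord_ring K m)%qT p) =
  gauss v (param_weight tau delta) (param s p).
Proof. by rewrite /point_val; congr gauss; apply: param_pi_eq => //; rewrite reprK. Qed.

Lemma point_val_Xan : Xan v point_val.
Proof.
have [gNy g0 g1 gM gD] := gauss_valuation vP (param_weightNy tauNy deltaNy).
have param0 : param s (0 : coord_poly K m) = 0 by rewrite /param raddf0.
have param1 : param s (1 : coord_poly K m) = 1 by rewrite /param rmorph1.
split; last by move=> c; rewrite point_val_pi paramC gaussC //; exact: param_weightNy.
split.
- by move=> f; exact: gNy.
- have <- : \pi_(coord_ring K m)%qT (0 : coord_poly K m) = 0 by exact: pi_zeror.
  by rewrite point_val_pi param0.
- have <- : \pi_(coord_ring K m)%qT (1 : coord_poly K m) = 1 by exact: pi_oner.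
  by rewrite point_val_pi param1.
- elim/quotW => p; elim/quotW => q.
  by rewrite -pi_mulr !point_val_pi /param rmorphM gM.
- elim/quotW => p; elim/quotW => q.
  by rewrite -pi_addr !point_val_pi /param rmorphD.
Qed.

Lemma trop_point_val e : trop point_val e =
  gauss v (param_weight tau delta) (param_coord K s e).
Proof.
rewrite /trop /ring_coord point_val_pi /param comp_mpolyXU -tnth_nth tnth_mktuple.
by rewrite enum_rankK.
Qed.

End PointValuation.

Section TropicalPoint.
Variables (R : realType) (K : fieldType) (v : K -> \bar R) (m : nat).
Hypothesis vP : ring_valuation v.

(** The values of [w] on the antisymmetric coordinates satisfy the hypotheses of
    [tropical_plucker_param]: symmetry because signs have value zero, the inequality by the
    three-term relation. *)
Lemma Trop_param (xi : trop_space R m) : Trop v xi ->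
  exists (s : {perm 'I_m}) (tau delta : 'I_m -> \bar R),
  [/\ forall i, tau i != -oo%E, forall q, delta q != -oo%E &
    forall e, xi e = gauss v (param_weight tau delta) (param_coord K s e)].
Proof.
move=> [w [wP _] <-].
pose X i j := w (\pi_(coord_ring K m)%qT (plucker K i j)).
have [wNy _ _ wM wD] := wP.
have X_sym i j : X i j = X j i.
  rewrite /X -(valuationN wP) -pi_oppr; congr w; apply: ring_pi_eq => x [y [z xE]].
  by rewrite coord_evalE mevalN -coord_evalE !(coord_eval_plucker _ _ xE) opprB.
have X_plucker i j k l : (Order.min (X i j + X k l) (X i l + X j k) <= X i k + X j l)%E.
  rewrite /X -!wM -!pi_mulr (plucker_relation K i j k l) pi_addr; exact: wD.
have [s [tau [delta [tNy dNy sP]]]] :=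
  tropical_plucker_param (fun i j => wNy _) X_sym X_plucker.
exists s, tau, delta; split=> // e.
(* At a minimal gap [q0] the upper and the lower bound for [X i j] meet. *)
have XE i j (q0 : 'I_m) : (s i < s j)%N -> (s i <= q0 < s j)%N ->
    (forall q : 'I_m, (s i <= q < s j)%N -> (delta q0 <= delta q)%E) ->
    X i j = (tau i + tau j + delta q0)%E.
  move=> ij q0in q0min; have [le [q qij ge]] := sP i j ij.
  apply/eqP; rewrite eq_le le //=; apply: le_trans ge; apply: leeD => //.
  exact: q0min.
have topmin q : in_arc s e q -> (delta (arc_top s delta e) <= delta q)%E.
  by move=> /(@arc_top_min _ _ s delta); rewrite lexi_pair => /andP[].
rewrite gauss_param_coord //.
have -> : trop w e = X (val e).1 (val e).2.
  rewrite /trop /X /plucker (_ : (_, _) = val e); last by case: (val e).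
  by rewrite valK.
have topin := arc_top_in s delta e.
rewrite /in_arc /arc_lo /arc_hi in topmin topin.
have [lt|lt|eq] := ltngtP (s (val e).1) (s (val e).2).
- rewrite (minn_idPl (ltnW lt)) (maxn_idPr (ltnW lt)) in topmin topin.
  exact: XE.
- rewrite (minn_idPr (ltnW lt)) (maxn_idPl (ltnW lt)) in topmin topin.
  by rewrite X_sym (addeC (tau _)); exact: XE.
- by move: (arc_ends_neq s e); rewrite eq eqxx.
Qed.

End TropicalPoint.

(** * Definition of the section and its value at a tropical point *)

Section TropicalSection.
Variables (R : realType) (K : fieldType) (v : K -> \bar R) (m : nat).
Hypothesis vP : ring_valuation v.
Hypothesis aoo : exists2 a : K, a != 0 & forall k : int, a ^ k = 1 -> k = 0.

(** The lift depends on [s] and [f] but not on the tropical point, so continuity only concerns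
    finitely many fixed polynomials for each [f]. *)
Definition lift (s : {perm 'I_m}) (f : coord_ring K m) : coord_poly K m :=
  sval (cid (straighten_ring s f)).

Lemma lift_noncrossing s f : noncrossing_poly s (lift s f).
Proof. by rewrite /lift; case: cid => F []. Qed.

Lemma pi_lift s f : \pi_(coord_ring K m)%qT (lift s f) = f.
Proof. by rewrite /lift; case: cid => F []. Qed.

Definition coord_weight (xi : trop_space R m) (k : 'I_#|{: ordpair m}|) : \bar R :=
  xi (enum_val k).

(** The maximum over all orders avoids choosing an order adapted to [xi]. *)
Definition trop_section (xi : trop_space R m) : val_space R K m :=
  fun f => (\big[maxe/-oo]_(s : {perm 'I_m}) gauss v (coord_weight xi) (lift s f))%E.

Section AtPoint.
Variables (xi : trop_space R m) (s : {perm 'I_m}) (tau delta : 'I_m -> \bar R).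
Hypothesis tauNy : forall i, tau i != -oo%E.
Hypothesis deltaNy : forall q, delta q != -oo%E.
Hypothesis xiE : forall e, xi e = gauss v (param_weight tau delta) (param_coord K s e).

Let coord_weightE : coord_weight xi = param_trop v s tau delta.
Proof. by apply/funext => k; rewrite /coord_weight xiE. Qed.

Lemma point_val_noncrossing F : noncrossing_poly s F ->
  point_val v s tau delta (\pi_(coord_ring K m)%qT F) = gauss v (coord_weight xi) F.
Proof. by move=> nF; rewrite point_val_pi // gauss_param_noncrossing // coord_weightE. Qed.

(** For an order [s] adapted to [xi] the maximum is attained at [s], where the lift gives equality;
    the lifts for other orders are bounded by [param_trop_le]. *)
Lemma trop_section_point : trop_section xi = point_val v s tau delta.
Proof.
apply/funext => f; apply/eqP; rewrite eq_le; apply/andP; split.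
  apply: bigmax_le => [|r _]; first exact: leNye.
  rewrite -{2}(pi_lift r f) point_val_pi // coord_weightE.
  exact: param_trop_le.
rewrite -{1}(pi_lift s f) point_val_noncrossing; last exact: lift_noncrossing.
by apply: (@le_bigmax_seq _ _ _ _ _ s); rewrite ?mem_index_enum.
Qed.

(** Any noncrossing representative computes the section, not only the chosen lift; equivariance
    applies this to weight components. *)
Lemma trop_section_noncrossing F : noncrossing_poly s F ->
  trop_section xi (\pi_(coord_ring K m)%qT F) = gauss v (coord_weight xi) F.
Proof. by rewrite trop_section_point; exact: point_val_noncrossing. Qed.

Lemma trop_section_Xan : Xan v (trop_section xi).
Proof. by rewrite trop_section_point; exact: point_val_Xan. Qed.

Lemma trop_trop_section : trop (trop_section xi) = xi.
Proof.
by apply/funext => e; rewrite trop_section_point trop_point_val // -xiE.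
Qed.

End AtPoint.

(** The torus only shifts the scales, so the same order and gaps serve [xi] and its translate. *)
Lemma trop_act_param (t : 'I_m -> R) xi s tau delta :
  (forall i, tau i != -oo%E) -> (forall q, delta q != -oo%E) ->
  (forall e, xi e = gauss v (param_weight tau delta) (param_coord K s e)) ->
  forall e, trop_act t xi e =
    gauss v (param_weight (fun i => (t i)%:E + tau i)%E delta) (param_coord K s e).
Proof.
move=> tauNy deltaNy xiE e; rewrite /trop_act xiE !gauss_param_coord //; last first.
  by move=> i; rewrite adde_eq_ninfty negb_or tauNy.
by rewrite EFinD addeA; congr (_ + _)%E; rewrite addeACA.
Qed.

Lemma mono_weight_act (t : 'I_m -> R) xi (M : multinom #|{: ordpair m}|) :
  mono_weight (coord_weight (trop_act t xi)) M =
  (mono_weight (coord_weight xi) M + (\sum_i (mono_wt M i)%:~R * t i)%:E)%E.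
Proof.
rewrite mono_wt_dot addeC.
have sumE (F : ordpair m -> R) :
    (\sum_e F e *+ arc_mult M e)%:E = \sum_e ((F e)%:E *+ arc_mult M e)%R.
  rewrite (big_morph EFin (@EFinD R) (erefl _)); apply: eq_bigr => e _.
  by elim: (arc_mult M e) => [|j IH]; rewrite ?mulr0n // !mulrS EFinD IH.
rewrite sumE (reindex (@enum_val (ordpair m) predT)) /=; last first.
  by exists enum_rank => e _; rewrite ?enum_rankK ?enum_valK.
rewrite /mono_weight -big_split; apply: eq_bigr => k _ /=.
by rewrite /arc_mult enum_valK -mulrnDl.
Qed.

(** The second branch remains a sum because [xi] may take the value [-oo] here. *)
Lemma gauss_component_term xi F b k :
  gauss_term v (coord_weight xi) (poly_component F b) k =
  if mono_wt k == b then gauss_term v (coord_weight xi) F k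
  else (+oo + mono_weight (coord_weight xi) k)%E.
Proof.
rewrite /gauss_term mcoeff_component; case: ifP => // _.
by case: vP => _ ->.
Qed.

End TropicalSection.

(** * Equivariance of the section *)

Section Equivariance.
Variables (R : realType) (K : fieldType) (v : K -> \bar R) (m : nat).
Hypothesis v_val : field_valuation v.
Hypothesis v_surj : forall r : \bar R, r != -oo%E -> exists a, v a = r.

Let vP : ring_valuation v. Proof. by case: v_val. Qed.
Let aoo := field_val_order v_val v_surj.

(** For an order adapted to [xi], both sides are minima over the terms of one noncrossing
    polynomial, each term shifted by its weight paired with [t]; [mu] merely groups the terms by
    weight. *)
Lemma trop_section_act (t : 'I_m -> R) (xi : trop_space R m) : Trop v xi ->
  trop_section v (trop_act t xi) = mu t (trop_section v xi).
Proof.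
move=> /(Trop_param vP)[s [tau [delta [tNy dNy xiE]]]].
have tNy' i : ((t i)%:E + tau i)%E != -oo%E.
  by rewrite adde_eq_ninfty negb_or tNy.
have xiE' := trop_act_param vP t tNy dNy xiE.
apply/funext => f; have nF := @lift_noncrossing K m s f.
rewrite -(pi_lift s f); move: (lift s f) nF => F nF.
rewrite (trop_section_noncrossing vP aoo tNy' dNy xiE' nF).
(* Uniqueness of weight decompositions identifies the components of the class of [F] with the
   classes of the components of [F]. *)
have compE b : trop_section v xi (weight_component (\pi_(coord_ring K m)%qT F) b) =
    gauss v (coord_weight xi) (poly_component F b).
  have <- := (weight_componentP _ v_val v_surj _).1 (poly_component_decomposition F).
  by apply: (trop_section_noncrossing vP aoo tNy dNy xiE); exact: noncrossing_component.
have xNy k : coord_weight xi k != -oo%E.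
  by rewrite /coord_weight xiE; apply: gaussNy => //; exact: param_weightNy.
have termE k : (gauss_term v (coord_weight xi) F k +
      (\sum_i (mono_wt k i)%:~R * t i)%:E)%E =
    gauss_term v (coord_weight (trop_act t xi)) F k.
  by rewrite /gauss_term mono_weight_act addeA.
apply/eqP; rewrite eq_le; apply/andP; split.
  apply: le_ereal_inf_tmp => _ [b _ <-]; rewrite compE -leeBlDr //.
  apply: le_gauss => k; rewrite leeBlDr // (gauss_component_term vP).
  case: eqP => [<-|_]; last by rewrite addye ?mono_weightNy // addye ?leey.
  rewrite termE; apply: gauss_le => // k'.
  by rewrite /coord_weight xiE'; apply: gaussNy => //; exact: param_weightNy.
apply: le_bigmine => k kF; rewrite -termE.
apply: (@le_trans _ _ (gauss v (coord_weight xi) (poly_component F (mono_wt k)) +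
    (\sum_i (mono_wt k i)%:~R * t i)%:E)%E).
  by apply: ereal_inf_lbound; exists (mono_wt k); rewrite ?compE.
apply: leeD => //; apply: le_trans (gauss_le vP xNy _ k) _.
by rewrite (gauss_component_term vP) eqxx.
Qed.

Lemma trop_act0 (xi : trop_space R m) : trop_act (fun=> 0) xi = xi.
Proof. by apply/funext => e; rewrite /trop_act addr0 add0e. Qed.

End Equivariance.

(** * Continuity of the section and conclusion *)

Lemma ptws_continuous_at (T U : topologicalType) (I : Type)
    (h : T -> {ptws I -> U}) (x : T) :
  (forall i, h y i @[y --> x] --> h x i) -> {for x, continuous h}.
Proof.
move=> H; apply/cvg_sup => i V.
have /= -> := @nbhsE (initial_topology (fun g : I -> U => g i)) (h x).
case=> B [[C oC <-] Cf] /filterS; apply; apply: (H i).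
exact: open_nbhs_nbhs.
Qed.

Section SectionContinuity.
Variables (R : realType) (K : fieldType) (v : K -> \bar R) (m : nat).
Hypothesis vP : ring_valuation v.

Lemma trop_section_cvg (xi : trop_space R m) : (forall e, xi e != -oo%E) ->
  {for xi, continuous (@trop_section R K v m)}.
Proof.
move=> xNy.
apply: (@ptws_continuous_at (trop_space R m) (\bar R) (coord_ring K m) (@trop_section R K v m) xi).
move=> f.
have H (s : {perm 'I_m}) : gauss v (coord_weight x) (lift s f) @[x --> xi] -->
    gauss v (coord_weight xi) (lift s f).
  move: (lift s f) => p.
  apply: (@cvg_gauss _ _ _ _ (nbhs xi) _ _ (fun i x => coord_weight x i)) => //.
    by move=> i; exact: xNy.
  move=> i.
  exact: (@proj_continuous _ (fun=> \bar R) (enum_val i) xi).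
rewrite /trop_section.
have := @cvg_big _ _ _ -oo%E xpredT max_continuous _ (nbhs xi) (index_enum _)
  (fun s x => gauss v (coord_weight x) (lift s f)) _ _ (fun s _ => H s).
exact.
Qed.

End SectionContinuity.

Theorem theorem5p1 (R : realType) (K : fieldType) (v : K -> \bar R)
    (v_val : field_valuation v)
    (v_surj : forall r : \bar R, r != -oo%E -> exists a, v a = r)
    (m : nat) :
  exists s : trop_space R m -> val_space R K m,
    [/\ forall xi, Trop v xi -> mu_image v (s xi),
        forall xi, Trop v xi -> trop (s xi) = xi,
        {within Trop v, continuous s} &
        forall (tau : 'I_m -> R) xi, Trop v xi ->
          s (trop_act tau xi) = mu tau (s xi)].
Proof.
have vP : ring_valuation v by case: v_val.
have aoo := field_val_order v_val v_surj.
exists (@trop_section R K v m); split.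
- move=> xi xiT.
  have [s [tau [delta [tNy dNy xiE]]]] := Trop_param vP xiT.
  have xan := trop_section_Xan vP aoo tNy dNy xiE.
  (* By equivariance at the zero vector, the section at [xi] is its own image under [mu]. *)
  split=> //; exists (fun=> 0), (trop_section v xi); split=> //.
  by rewrite -trop_section_act // trop_act0.
- move=> xi /(Trop_param vP)[s [tau [delta [tNy dNy xiE]]]].
  exact: trop_trop_section xiE.
(* Tropical points have no coordinate [-oo], so the section is continuous at them even in the
   ambient space. *)
- apply: continuous_in_subspaceT => xi /set_mem[w [[wNy _ _ _ _] _] <-].
  by apply: trop_section_cvg => // e; exact: wNy.
- by move=> tau xi; exact: trop_section_act.
Qed.
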